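(* Embed an $\mathrm{SU}(3)$-manifold $(M^6,g,\phi)$ as a hypersurface in some $\mathrm{G}_2$-manifold $(\bar M^7,\bar g,\phi)$, with transverse unit direction $V$, so that $T\bar M^7=TM^6\oplus\langle V\rangle$ and the $\mathrm{SU}(3)$-structure of $M^6$ is given by the restriction of the spinor $\phi$ of $\bar M^7$. Suppose the $\mathrm{G}_2$-structure is parallel in the normal direction: $\bar\nabla_V\phi=0$. Then the class $\mathcal{W}_\alpha$ of $(\bar M^7,\bar g,\phi)$ depends on the column position (the class of $M^6$) and the row position (the Weingarten type of $M^6$) as in the table $$\begin{array}{c|ccccccc} & \chi_1 & \chi_{\bar1} & \chi_2 & \chi_{\bar2} & \chi_3 & \chi_4 & \chi_5\\ \hline \text{type zero} & \mathcal{W}_{13} & \mathcal{W}_4 & \mathcal{W}_3 & \mathcal{W}_2 & \mathcal{W}_3 & \mathcal{W}_{24} & \mathcal{W}_{234}\\ \text{type one} & \mathcal{W}_{134} & \mathcal{W}_4 & \mathcal{W}_{34} & \mathcal{W}_{24} & \mathcal{W}_{34} & \mathcal{W}_{24} & \mathcal{W}_{234}\\ \text{type two} & \mathcal{W}_{123} & \mathcal{W}_{24} & \mathcal{W}_{23} & \mathcal{W}_2 & \mathcal{W}_{23} & \mathcal{W}_{24} & \mathcal{W}_{234}\\ \text{type three} & \mathcal{W}_{13} & \mathcal{W}_{34} & \mathcal{W}_3 & \mathcal{W}_{23} & \mathcal{W}_3 & \mathcal{W}_{234} & \mathcal{W}_{234} \end{array}$$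
   Context: Conventions. Clifford algebras satisfy $X^2=-|X|^2$. $\bar\Sigma$ is the real rank-8 spinor bundle of the oriented Riemannian spin manifold $\bar M^7$ (with $e_1\cdots e_7=-\mathrm{Id}$ for positively oriented orthonormal frames), with inner product $(\cdot,\cdot)$ for which vectors act skew-symmetrically; Clifford multiplication of $\bar M^7$ is written as juxtaposition, and $\bar\nabla$ is the Levi-Civita connection and its spinor lift. A $\mathrm{G}_2$-manifold $(\bar M^7,\bar g,\phi)$ is such an $\bar M^7$ with a global unit spinor field $\phi$; its 3-form is $\Psi(X,Y,Z)=(XYZ\phi,\phi)$, and its intrinsic endomorphism $\bar S$ is the unique endomorphism field of $T\bar M^7$ with $\bar\nabla_X\phi=\bar S(X)\phi$. $\mathrm{G}_2$ classes: $\mathrm{End}(\mathbb{R}^7)=\mathcal{W}_1\oplus\mathcal{W}_2\oplus\mathcal{W}_3\oplus\mathcal{W}_4$ under $\mathrm{G}_2$, with $\mathcal{W}_1=\mathbb{R}\,\mathrm{Id}$; $\mathcal{W}_2=\mathfrak{g}_2$; $\mathcal{W}_3$ the symmetric traceless endomorphisms; $\mathcal{W}_4=\{Z\lrcorner\Psi : Z\in\mathbb{R}^7\}$ (2-forms identified with skew endomorphisms by the metric). Multiple indices denote direct sums, e.g. $\mathcal{W}_{13}=\mathcal{W}_1\oplus\mathcal{W}_3$. The class of $(\bar M^7,\bar g,\phi)$ is $\mathcal{W}_\alpha$ when $\bar S$ takes values in $\mathcal{W}_\alpha$. Hypersurface. $M^6$ has unit normal $V$ and is oriented so that (oriented frame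 of $M^6$, $V$) is oriented in $\bar M^7$. Its spinor bundle is the restriction of $\bar\Sigma$, with Clifford multiplication $X\cdot\phi:=VX\phi$; $\nabla$ is its Levi-Civita connection and spinor lift. The Weingarten map $W$ is the endomorphism of $TM^6$ for which $g(W(X),Y)$ is the second fundamental form, so that $\bar\nabla_XY=\nabla_XY+g(W(X),Y)V$ and, on spinors, $\bar\nabla_X\phi=\nabla_X\phi-\frac12VW(X)\phi$. With $j:=e_1\cdots e_6$ the Clifford volume element of $M^6$ ($j^2=-1$, anticommuting with Clifford multiplication by vectors of $M^6$), the unit spinor $\phi$ on $M^6$ defines an $\mathrm{SU}(3)$-structure with almost complex structure $J$ given by $(JX)\cdot\phi=j(X\cdot\phi)$, and intrinsic tensors $(S,\eta)$ (an endomorphism field and a 1-form) uniquely given by $\nabla_X\phi=\eta(X)j(\phi)+S(X)\cdot\phi$. $\mathrm{SU}(3)$ classes, in terms of $(S,\eta)$: $\chi_1$: $S=\lambda J$ with $\lambda\in\mathbb{R}$, $\eta=0$; $\chi_{\bar1}$: $S=\mu\,\mathrm{Id}$ with $\mu\in\mathbb{R}$, $\eta=0$; $\chi_2$: $S\in\mathfrak{su}(3)$ (that is, $S$ skew, $SJ=JS$, $\mathrm{tr}(JS)=0$), $\eta=0$; $\chi_{\bar2}$: $S$ symmetric traceless, $SJ=JS$, $\eta=0$; $\chi_3$: $S$ symmetric traceless, $SJ=-JS$, $\eta=0$; $\chi_4$: $S$ skew, $SJ=-JS$, $\eta=0$; $\chi_5$: $S=0$, $\eta\neq0$. Weingarten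 types of the hypersurface: type zero: $W$ is the trivial map, $W=0$ (meaning $\bar\nabla=\nabla$); type one: $W$ is of class $\chi_{\bar1}$ (a multiple of $\mathrm{Id}$); type two: $W$ is of class $\chi_{\bar2}$ (symmetric, traceless, commuting with $J$); type three: $W$ is of class $\chi_3$ (symmetric, traceless, anticommuting with $J$).
   Formalization: The class of the G2-manifold is asserted only at the points of the hypersurface M^6: the hypotheses concern M^6 alone, and away from it the spinor may vary freely (e.g. flat T^6 in T^7), so the claim on all of the 7-manifold fails. *)

(* Defs.v *)
From HB Require Import structures.
From mathcomp Require Import all_boot all_order all_algebra.
From mathcomp Require Import all_classical all_reals all_analysis.

Set Implicit Arguments.
Unset Strict Implicit.
Unset Printing Implicit Defensive.

Import Order.TTheory GRing.Theory Num.Theory.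
Import numFieldNormedType.Exports.
Local Open Scope classical_set_scope.
Local Open Scope ring_scope.

Fixpoint Ck (R : realType) (A B : normedModType R) (k : nat) (U : set A)
    (h : A -> B) {struct k} : Prop :=
  if k is k'.+1 then
    (forall x, U x -> differentiable h x) /\ (forall v, Ck k' U ('D_v h))
  else forall x, U x -> {for x, continuous h}.

Definition Csmooth (R : realType) (A B : normedModType R) (U : set A)
    (h : A -> B) := forall k, Ck k U h.

Record chart (R : realType) (n : nat) (T : topologicalType) := Chart {
  dom : set T;
  coord : T -> 'rV[R]_n;
  param : 'rV[R]_n -> T;
  open_dom : open dom;
  open_coord : open (coord @` dom);
  coordK : forall p, dom p -> param (coord p) = p;
  coord_cont : forall p, dom p -> {for p, continuous coord};
  param_cont : forall x, (coord @` dom) x -> {for x, continuous param} }.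

(* The atlas is indexed by the points of the manifold: every point carries a
   preferred chart around it.  Any smooth atlas has such a subatlas, which
   generates the same smooth structure. *)
Record manifold (R : realType) (n : nat) := Manifold {
  points :> topologicalType;
  manifold_hausdorff : hausdorff_space points;
  manifold_countable : @second_countable points;
  chart_at : points -> chart R n points;
  chart_at_dom : forall p, dom (chart_at p) p;
  chart_at_smooth : forall p q,
    Csmooth (coord (chart_at p) @` (dom (chart_at p) `&` dom (chart_at q)))
            (coord (chart_at q) \o param (chart_at p)) }.

(* "Smooth at p" always means: smooth on some neighbourhood of p. *)
Definition smooth_at (R : realType) (n : nat) (M : manifold R n)
    (B : normedModType R) (h : M -> B) (p : M) :=
  exists U : set 'rV[R]_n,
    [/\ open U, U (coord (chart_at p) p),
        U `<=` coord (chart_at p) @` dom (chart_at p) &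
        Csmooth U (h \o param (chart_at p))].

Definition smooth_fun_at (R : realType) (n : nat) (M : manifold R n)
    (h : M -> R) (p : M) := @smooth_at R n M R^o h p.

(* The tangent space at p is 'rV[R]_n: a tangent vector is given by its
   coordinates in the preferred chart at p.  [dirder p v h] is the derivative
   v(h) of the function h. *)
Definition dirder (R : realType) (n : nat) (M : manifold R n) (p : M)
    (v : 'rV[R]_n) (h : M -> R) : R :=
  'D_v ((h : M -> R^o) \o param (chart_at p)) (coord (chart_at p) p).

Definition smooth_map (R : realType) (m n : nat) (M : manifold R m)
    (N : manifold R n) (f : M -> N) :=
  continuous f /\ forall p, smooth_at (coord (chart_at (f p)) \o f) p.

(* Matrices of linear maps act on row vectors from the right: the
   differential of f maps v to [v *m dmap f p]. *)
Definition dmap (R : realType) (m n : nat) (M : manifold R m)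
    (N : manifold R n) (f : M -> N) (p : M) : 'M[R]_(m, n) :=
  jacobian (coord (chart_at (f p)) \o f \o param (chart_at p))
           (coord (chart_at p) p).

Definition embedding (R : realType) (m n : nat) (M : manifold R m)
    (N : manifold R n) (f : M -> N) :=
  [/\ smooth_map f,
      forall (p : M) (v : 'rV[R]_m), v *m dmap f p = 0 -> v = 0,
      injective f &
      forall O : set M, open O -> exists2 O' : set N, open O' & O = f @^-1` O'].

(* An orientation is a sign at every point, comparing the orientation with the
   one of the preferred chart at that point. *)
Record orientation (R : realType) (n : nat) (M : manifold R n) := Orientation {
  osign :> M -> R;
  osign_unit : forall p, osign p = 1 \/ osign p = -1;
  osign_compat : forall p, \forall q \near p,
    0 < osign p * osign q *
        \det (jacobian (coord (chart_at p) \o param (chart_at q))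
                       (coord (chart_at q) q)) }.

(* The rows of e form a positively oriented frame. *)
Definition pos_frame (R : realType) (n : nat) (M : manifold R n)
    (o : orientation M) (p : M) (e : 'M[R]_n) := 0 < o p * \det e.

(* [smooth_sec s p] : the section s is smooth on a neighbourhood of p. *)
Record bundle (R : realType) (n : nat) (M : manifold R n) := Bundle {
  fib :> M -> lmodType R;
  smooth_sec : (forall q, fib q) -> M -> Prop }.

Definition vector_bundle (R : realType) (n : nat) (M : manifold R n) (r : nat)
    (E : bundle M) :=
  forall p, exists e : 'I_r -> forall q, E q,
    [/\ \forall q \near p, forall x : E q,
          exists! a : 'I_r -> R, x = \sum_(i < r) a i *: e i q,
        forall i, \forall q \near p, smooth_sec (e i) q &
        forall s : forall q, E q, smooth_sec s p <->
          exists2 a : 'I_r -> M -> R, forall i, smooth_fun_at (a i) p &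
            \forall q \near p, s q = \sum_(i < r) a i q *: e i q].

Definition tangent (R : realType) (n : nat) (M : manifold R n) : bundle M :=
  @Bundle R n M (fun _ => 'rV[R]_n)
    (fun X p => forall h : M -> R, smooth_fun_at h p ->
       smooth_fun_at (fun q => dirder q (X q) h) p).

(* Smooth sections of f^*E are locally the C^oo(M)-combinations of the
   sections s \o f, with s a smooth section of E. *)
Definition pullback (R : realType) (m n : nat) (M : manifold R m)
    (N : manifold R n) (f : M -> N) (E : bundle N) : bundle M :=
  @Bundle R m M (fun p => E (f p))
    (fun s p => exists k : nat, exists a : 'I_k -> M -> R,
       exists t : 'I_k -> forall q, E q,
       [/\ forall i, smooth_fun_at (a i) p,
           forall i, smooth_sec (t i) (f p) &
           \forall q \near p, s q = \sum_(i < k) a i q *: t i (f q)]).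

Record bmetric (R : realType) (n : nat) (M : manifold R n) (E : bundle M) :=
  BMetric {
  bform :> forall p, E p -> E p -> R;
  bform_lin : forall p (a : R) (x y z : E p),
    bform (a *: x + y) z = a * bform x z + bform y z;
  bform_sym : forall p (x y : E p), bform x y = bform y x;
  bform_pos : forall p (x : E p), x <> 0 -> 0 < bform x x;
  bform_smooth : forall (s t : forall q, E q) p,
    smooth_sec s p -> smooth_sec t p ->
    smooth_fun_at (fun q => bform (s q) (t q)) p }.

Record connection (R : realType) (n : nat) (M : manifold R n) (E : bundle M) :=
  Connection {
  nabla :> forall p : M, 'rV[R]_n -> (forall q, E q) -> E p;
  nabla_lin : forall p (a : R) (v w : 'rV[R]_n) (s : forall q, E q),
    smooth_sec s p -> nabla p (a *: v + w) s = a *: nabla p v s + nabla p w s;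
  nabla_add : forall p (v : 'rV[R]_n) (s t : forall q, E q),
    smooth_sec s p -> smooth_sec t p ->
    nabla p v (fun q => s q + t q) = nabla p v s + nabla p v t;
  nabla_leibniz : forall p (v : 'rV[R]_n) (h : M -> R) (s : forall q, E q),
    smooth_fun_at h p -> smooth_sec s p ->
    nabla p v (fun q => h q *: s q) = dirder p v h *: s p + h p *: nabla p v s;
  nabla_local : forall p (v : 'rV[R]_n) (s t : forall q, E q),
    smooth_sec s p -> smooth_sec t p ->
    (\forall q \near p, s q = t q) -> nabla p v s = nabla p v t;
  nabla_smooth : forall p (X : forall q, tangent M q) (s : forall q, E q),
    smooth_sec X p -> smooth_sec s p ->
    smooth_sec (fun q => nabla q (X q) s) p }.

Definition pullback_connection (R : realType) (m n : nat) (M : manifold R m)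
    (N : manifold R n) (f : M -> N) (E : bundle N) (D : connection E)
    (Df : connection (pullback f E)) :=
  forall (p : M) (v : 'rV[R]_m) (s : forall q, E q), smooth_sec s (f p) ->
    Df p v (fun q => s (f q)) = D (f p) (v *m dmap f p) s.

Definition metric_connection (R : realType) (n : nat) (M : manifold R n)
    (E : bundle M) (b : forall p, E p -> E p -> R) (D : connection E) :=
  forall (p : M) (v : 'rV[R]_n) (s t : forall q, E q),
    smooth_sec s p -> smooth_sec t p ->
    dirder p v (fun q => b q (s q) (t q)) =
      b p (D p v s) (t p) + b p (s p) (D p v t).

(* The torsion-free condition D_X Y - D_Y X = [X, Y] is tested on functions. *)
Definition levi_civita (R : realType) (n : nat) (M : manifold R n)
    (g : bmetric (tangent M)) (D : connection (tangent M)) :=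
  metric_connection g D /\
  forall (p : M) (X Y : forall q, tangent M q) (h : M -> R),
    smooth_sec X p -> smooth_sec Y p -> smooth_fun_at h p ->
    dirder p (D p (X p) Y - D p (Y p) X) h =
      dirder p (X p) (fun q => dirder q (Y q) h) -
      dirder p (Y p) (fun q => dirder q (X q) h).

(* The rows of e form an orthonormal frame. *)
Definition orthonormal_frame (R : realType) (n : nat) (M : manifold R n)
    (g : bmetric (tangent M)) (p : M) (e : 'M[R]_n) :=
  forall i j : 'I_n, g p (row i e) (row j e) = (i == j)%:R.

(* The Clifford product e_1 (e_2 (... (e_n x))) over the rows e_i of e. *)
Definition frame_product (R : realType) (n : nat) (F : lmodType R)
    (c : 'rV[R]_n -> F -> F) (e : 'M[R]_n) (x : F) : F :=
  foldr (fun i y => c (row i e) y) x (enum 'I_n).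

(* A spin structure on an oriented Riemannian 7-manifold amounts to a real
   rank-8 bundle of modules over its Clifford bundle, on which the volume
   element acts as -Id. *)
Record spinor_bundle (R : realType) (M : manifold R 7)
    (g : bmetric (tangent M)) (o : orientation M) := SpinorBundle {
  spinors :> bundle M;
  spinors_bundle : vector_bundle 8 spinors;
  sprod : bmetric spinors;
  cliff : forall p : M, 'rV[R]_7 -> spinors p -> spinors p;
  cliff_linl : forall p (a : R) (v w : 'rV[R]_7) (x : spinors p),
    cliff (a *: v + w) x = a *: cliff v x + cliff w x;
  cliff_linr : forall p (a : R) (v : 'rV[R]_7) (x y : spinors p),
    cliff v (a *: x + y) = a *: cliff v x + cliff v y;
  cliff_sqr : forall p (v : 'rV[R]_7) (x : spinors p),
    cliff v (cliff v x) = - g p v v *: x;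
  cliff_skew : forall p (v : 'rV[R]_7) (x y : spinors p),
    sprod p (cliff v x) y = - sprod p x (cliff v y);
  cliff_vol : forall p (e : 'M[R]_7) (x : spinors p),
    orthonormal_frame g p e -> pos_frame o p e ->
    frame_product (@cliff p) e x = - x;
  cliff_smooth : forall (X : forall q, tangent M q) (s : forall q, spinors q) p,
    smooth_sec X p -> smooth_sec s p ->
    smooth_sec (fun q => cliff (X q) (s q)) p }.

(* The spinor lift of D: the metric connection for which Clifford
   multiplication c is parallel.  It is unique on the bundles considered here,
   since only real multiples of Id commute with Clifford multiplication. *)
Definition spin_lift (R : realType) (n : nat) (M : manifold R n)
    (E : bundle M) (b : forall p, E p -> E p -> R)
    (c : forall p : M, 'rV[R]_n -> E p -> E p)
    (D : connection (tangent M)) (DS : connection E) :=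
  metric_connection b DS /\
  forall (p : M) (v : 'rV[R]_n) (X : forall q, tangent M q)
         (s : forall q, E q),
    smooth_sec X p -> smooth_sec s p ->
    DS p v (fun q => c q (X q) (s q)) =
      c p (D p v X) (s p) + c p (X p) (DS p v s).

Definition unit_spinor_field (R : realType) (M : manifold R 7)
    (g : bmetric (tangent M)) (o : orientation M) (Sg : spinor_bundle g o)
    (phi : forall q, Sg q) :=
  forall p, smooth_sec phi p /\ sprod Sg p (phi p) (phi p) = 1.

Definition Psi (R : realType) (M : manifold R 7)
    (g : bmetric (tangent M)) (o : orientation M) (Sg : spinor_bundle g o)
    (phi : forall q, Sg q) (p : M) (X Y Z : 'rV[R]_7) : R :=
  sprod Sg p (cliff X (cliff Y (cliff Z (phi p)))) (phi p).

Definition intrinsic_endomorphism (R : realType) (M : manifold R 7)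
    (g : bmetric (tangent M)) (o : orientation M) (Sg : spinor_bundle g o)
    (phi : forall q, Sg q) (DS : connection Sg) (S : M -> 'M[R]_7) :=
  forall (p : M) (v : 'rV[R]_7), DS p v phi = cliff (v *m S p) (phi p).

Definition symmetric_endo (R : realType) (n : nat) (M : manifold R n)
    (g : bmetric (tangent M)) (p : M) (A : 'M[R]_n) :=
  forall X Y : 'rV[R]_n, g p (X *m A) Y = g p X (Y *m A).

Definition skew_endo (R : realType) (n : nat) (M : manifold R n)
    (g : bmetric (tangent M)) (p : M) (A : 'M[R]_n) :=
  forall X Y : 'rV[R]_n, g p (X *m A) Y = - g p X (Y *m A).

(* W_1, ..., W_4; W_2 is the Lie algebra g_2 of the stabiliser of Psi, and in
   W_4 the 2-form w corresponds to A through w(X, Y) = g(A X, Y). *)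
Definition G2_module (R : realType) (M : manifold R 7)
    (g : bmetric (tangent M)) (o : orientation M) (Sg : spinor_bundle g o)
    (phi : forall q, Sg q) (p : M) (i : nat) (A : 'M[R]_7) : Prop :=
  match i with
  | 1 => exists a : R, A = a%:M
  | 2 => skew_endo g p A /\ forall X Y Z : 'rV[R]_7,
      Psi phi p (X *m A) Y Z + Psi phi p X (Y *m A) Z +
      Psi phi p X Y (Z *m A) = 0
  | 3 => symmetric_endo g p A /\ \tr A = 0
  | 4 => exists Z : 'rV[R]_7, forall X Y : 'rV[R]_7,
      g p (X *m A) Y = Psi phi p Z X Y
  | _ => False
  end.

(* The sum of the W_i for i in the multi-index alpha. *)
Definition G2_class (R : realType) (M : manifold R 7)
    (g : bmetric (tangent M)) (o : orientation M) (Sg : spinor_bundle g o)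
    (phi : forall q, Sg q) (p : M) (alpha : seq nat) (A : 'M[R]_7) : Prop :=
  exists2 B : nat -> 'M[R]_7,
    forall i, i \in alpha -> G2_module phi p i (B i) &
    A = \sum_(i <- alpha) B i.

Definition unit_normal (R : realType) (N : manifold R 7)
    (gN : bmetric (tangent N)) (M : manifold R 6) (f : M -> N)
    (V : forall p, pullback f (tangent N) p) :=
  forall p, [/\ smooth_sec V p, gN (f p) (V p) (V p) = 1 &
                forall X : 'rV[R]_6, gN (f p) (X *m dmap f p) (V p) = 0].

Definition hyper_cliff (R : realType) (N : manifold R 7)
    (gN : bmetric (tangent N)) (o : orientation N) (Sg : spinor_bundle gN o)
    (M : manifold R 6) (f : M -> N) (V : forall p, pullback f (tangent N) p)
    (p : M) (X : 'rV[R]_6) (x : pullback f Sg p) : pullback f Sg p :=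
  @cliff _ _ _ _ Sg (f p) (V p) (cliff (X *m dmap f p) x).

(* M is oriented so that (oriented frame of M, V) is an oriented frame. *)
Definition hyper_pos_frame (R : realType) (N : manifold R 7)
    (o : orientation N) (M : manifold R 6) (f : M -> N)
    (V : forall p, pullback f (tangent N) p) (p : M) (e : 'M[R]_6) :=
  pos_frame o (f p) (col_mx (e *m dmap f p) (V p : 'rV[R]_7)).

Definition volume_element (R : realType) (N : manifold R 7)
    (gN : bmetric (tangent N)) (o : orientation N) (Sg : spinor_bundle gN o)
    (M : manifold R 6) (g : bmetric (tangent M)) (f : M -> N)
    (V : forall p, pullback f (tangent N) p)
    (j : forall p, pullback f Sg p -> pullback f Sg p) :=
  forall (p : M) (e : 'M[R]_6) (x : pullback f Sg p),
    orthonormal_frame g p e -> hyper_pos_frame o V p e ->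
    j p x = frame_product (@hyper_cliff R N gN o Sg M f V p) e x.

Definition almost_complex_structure (R : realType) (N : manifold R 7)
    (gN : bmetric (tangent N)) (o : orientation N) (Sg : spinor_bundle gN o)
    (M : manifold R 6) (f : M -> N) (V : forall p, pullback f (tangent N) p)
    (phi : forall q, Sg q) (j : forall p, pullback f Sg p -> pullback f Sg p)
    (J : M -> 'M[R]_6) :=
  forall (p : M) (X : 'rV[R]_6),
    hyper_cliff V (X *m J p) (phi (f p)) = j p (hyper_cliff V X (phi (f p))).

Definition intrinsic_tensors (R : realType) (N : manifold R 7)
    (gN : bmetric (tangent N)) (o : orientation N) (Sg : spinor_bundle gN o)
    (M : manifold R 6) (f : M -> N) (V : forall p, pullback f (tangent N) p)
    (phi : forall q, Sg q) (j : forall p, pullback f Sg p -> pullback f Sg p)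
    (DS : connection (pullback f Sg)) (S : M -> 'M[R]_6)
    (eta : M -> {scalar 'rV[R]_6}) :=
  forall (p : M) (X : 'rV[R]_6),
    DS p X (fun q => phi (f q)) =
      eta p X *: j p (phi (f p)) + hyper_cliff V (X *m S p) (phi (f p)).

(* g(W(X), Y) V is the second fundamental form, i.e. the difference of the
   Levi-Civita connections Df (pulled back to M) of the ambient manifold and D
   of the hypersurface. *)
Definition weingarten_map (R : realType) (N : manifold R 7) (M : manifold R 6)
    (g : bmetric (tangent M)) (f : M -> N)
    (V : forall p, pullback f (tangent N) p)
    (Df : connection (pullback f (tangent N))) (D : connection (tangent M))
    (W : M -> 'M[R]_6) :=
  forall (p : M) (v : 'rV[R]_6) (Y : forall q, tangent M q), smooth_sec Y p ->
    Df p v (fun q => (Y q *m dmap f q : tangent N (f q))) =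
      (D p v Y *m dmap f p : 'rV[R]_7) + g p (v *m W p) (Y p) *: V p.

Inductive SU3_type := chi1 | chi1bar | chi2 | chi2bar | chi3 | chi4 | chi5.

(* With the row convention, S o J is the matrix J *m S. *)
Definition SU3_class (R : realType) (M : manifold R 6)
    (g : bmetric (tangent M)) (J : M -> 'M[R]_6) (S : M -> 'M[R]_6)
    (eta : M -> {scalar 'rV[R]_6}) (c : SU3_type) : Prop :=
  let eta0 := forall p X, eta p X = 0 in
  match c with
  | chi1 => (forall p, exists l : R, S p = l *: J p) /\ eta0
  | chi1bar => (forall p, exists m : R, S p = m%:M) /\ eta0
  | chi2 => (forall p, [/\ skew_endo g p (S p), J p *m S p = S p *m J p &
                           \tr (S p *m J p) = 0]) /\ eta0
  | chi2bar => (forall p, [/\ symmetric_endo g p (S p), \tr (S p) = 0 &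
                              J p *m S p = S p *m J p]) /\ eta0
  | chi3 => (forall p, [/\ symmetric_endo g p (S p), \tr (S p) = 0 &
                           J p *m S p = - (S p *m J p)]) /\ eta0
  | chi4 => (forall p, skew_endo g p (S p) /\ J p *m S p = - (S p *m J p))
            /\ eta0
  | chi5 => (forall p, S p = 0) /\ exists p X, eta p X <> 0
  end.

Inductive weingarten_type := type_zero | type_one | type_two | type_three.

Definition weingarten_class (R : realType) (M : manifold R 6)
    (g : bmetric (tangent M)) (J : M -> 'M[R]_6) (W : M -> 'M[R]_6)
    (t : weingarten_type) : Prop :=
  match t with
  | type_zero => forall p, W p = 0
  | type_one => forall p, exists m : R, W p = m%:M
  | type_two => forall p, [/\ symmetric_endo g p (W p), \tr (W p) = 0 &
                              J p *m W p = W p *m J p]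
  | type_three => forall p, [/\ symmetric_endo g p (W p), \tr (W p) = 0 &
                                J p *m W p = - (W p *m J p)]
  end.

Definition G2_table (t : weingarten_type) (c : SU3_type) : seq nat :=
  match t, c with
  | type_zero, chi1 => [:: 1; 3]
  | type_zero, chi1bar => [:: 4]
  | type_zero, chi2 => [:: 3]
  | type_zero, chi2bar => [:: 2]
  | type_zero, chi3 => [:: 3]
  | type_zero, chi4 => [:: 2; 4]
  | type_zero, chi5 => [:: 2; 3; 4]
  | type_one, chi1 => [:: 1; 3; 4]
  | type_one, chi1bar => [:: 4]
  | type_one, chi2 => [:: 3; 4]
  | type_one, chi2bar => [:: 2; 4]
  | type_one, chi3 => [:: 3; 4]
  | type_one, chi4 => [:: 2; 4]
  | type_one, chi5 => [:: 2; 3; 4]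
  | type_two, chi1 => [:: 1; 2; 3]
  | type_two, chi1bar => [:: 2; 4]
  | type_two, chi2 => [:: 2; 3]
  | type_two, chi2bar => [:: 2]
  | type_two, chi3 => [:: 2; 3]
  | type_two, chi4 => [:: 2; 4]
  | type_two, chi5 => [:: 2; 3; 4]
  | type_three, chi1 => [:: 1; 3]
  | type_three, chi1bar => [:: 3; 4]
  | type_three, chi2 => [:: 3]
  | type_three, chi2bar => [:: 2; 3]
  | type_three, chi3 => [:: 3]
  | type_three, chi4 => [:: 2; 3; 4]
  | type_three, chi5 => [:: 2; 3; 4]
  end%N.

(* Main.v *)
(* The point is the formula SN(X) = J (S - W/2) X + eta(X) V for X tangent to the
   hypersurface and SN(V) = 0, after which the table is linear algebra: each
   class puts S - W/2, composed with J and extended by 0 on V, into the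
   expected modules.  The formula follows from j = V, V X phi = (J X) phi and
   the spinorial Gauss formula.  The latter holds because the difference of
   the two spinor connections, corrected by V W(X) / 2, is a skew endomorphism
   commuting with Clifford multiplication, hence kills phi.  The inclusions
   su(3) < g_2 and so(7) = g_2 + R^7 are read off from the action on phi of the
   bivector associated with a skew endomorphism. *)

From Pilot Require Import Defs.
From HB Require Import structures.
From mathcomp Require Import all_boot all_order all_algebra.
From mathcomp Require Import all_classical all_reals all_analysis.
From mathcomp Require Import perm ring lra.

Set Implicit Arguments.
Unset Strict Implicit.
Unset Printing Implicit Defensive.

Import Order.TTheory GRing.Theory Num.Theory.
Import numFieldNormedType.Exports.
Local Open Scope classical_set_scope.
Local Open Scope ring_scope.

Local Notation coord := Pilot.Defs.coord.
Local Notation dom := Pilot.Defs.dom.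

(** * Functions of class C^k *)

Section Calculus.
Variable R : realType.

(** The delicate point is that the data live over two bases: [DNS] differentiates spinor fields on
    N, [DS] spinor fields along [f], and neither V nor the tangent fields of M are given as
    restrictions of fields on N. The ambient spinor connection along [f] is therefore constructed,
    as [DS] minus an endomorphism L of one fibre; L exists because on restricted sections the
    difference of the two derivatives is tensorial. Product rules then pass from N to M by induction
    on the writing of a section along [f] as a combination of restrictions. Everything else happens
    in a single fibre, where the rank enters through 8 = 1 + 7: X |-> X phi is isometric, so every
    spinor is a phi + X phi, and spinor identities can be tested against phi and the X phi. In the
    table, S and W contribute independently, so outside the column [chi5] a cell is the union of a
    column contribution and a row contribution. *)

Lemma near0_differentiable (A B : normedModType R) (h : A -> B) x :
  (\near x, h x = 0) -> differentiable h x.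
Proof.
move=> e; have hx : h x = 0 := nbhs_singleton e.
apply/diffP => /=.
(* The differential is chosen by [get], so it is enough to exhibit one continuous linear map with
   the right remainder; the zero map is one. *)
apply: (@getPex _ (fun df : {linear A -> B} => continuous df /\
  forall y, h y = h (lim (nbhs x)) + df (y - lim (nbhs x))
                  +o_(y \near x) (y - lim (nbhs x)))).
exists (\0 : {linear A -> B}); split; first by move=> y; apply: cst_continuous.
have E : h =o_x (center x).
  by apply/eqoP => _ /posnumP[eps] /=; apply: filterS e => z ->; rewrite normr0 mulr_ge0.
by apply: eqaddoEx => y; rewrite lim_id // hx /= !add0r {1}E.
Qed.

Lemma near_eq_differentiable (A B : normedModType R) (h h' : A -> B) x :
  {near x, h =1 h'} -> differentiable h x -> differentiable h' x.
Proof.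
move=> e dh.
have -> : h' = h + (h' - h) by rewrite addrC subrK.
apply: differentiableD => //; apply: near0_differentiable.
by apply: filterS e => y /= E; rewrite !fctE E subrr.
Qed.

Lemma Ck_eq (A B : normedModType R) k (U : set A) (h h' : A -> B) :
  open U -> (forall x, U x -> h x = h' x) -> Ck k U h -> Ck k U h'.
Proof.
move=> oU; elim: k h h' => [|k IH] h h' e /=.
  move=> c x Ux; have hx := c _ Ux.
  have ne : \forall y \near x, h y = h' y.
    by apply: filterS (open_nbhs_nbhs (conj oU Ux)).
  by rewrite /prop_for /continuous_at -e //; apply: cvg_trans hx; apply: near_eq_cvg.
move=> [d c]; split.
  move=> x Ux.
  have ne : {near x, h =1 h'}.
    by apply: filterS (open_nbhs_nbhs (conj oU Ux)).
  by apply: near_eq_differentiable (d _ Ux).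
move=> v; apply: IH (c v) => x Ux.
apply: near_eq_derive.
by apply: filterS (open_nbhs_nbhs (conj oU Ux)).
Qed.

Lemma Ck_sub (A B : normedModType R) k (U U' : set A) (h : A -> B) :
  U' `<=` U -> Ck k U h -> Ck k U' h.
Proof.
move=> s; elim: k h => [|k IH] h /=; first by move=> c x /s; apply: c.
by move=> [d c]; split=> [x /s|v]; [apply: d|apply: IH].
Qed.

Lemma CkS (A B : normedModType R) k (U : set A) (h : A -> B) :
  Ck k.+1 U h -> Ck k U h.
Proof.
elim: k h => [|k IH] h /=.
  by move=> [d _] x /d; apply: differentiable_continuous.
by move=> [d c]; split=> // v; apply: IH; apply: c.
Qed.

Lemma Ck_cst (A B : normedModType R) k (U : set A) (b : B) :
  Ck k U (fun=> b).
Proof.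
elim: k b => [|k IH] b /=; first by move=> x _; apply: cst_continuous.
split=> [x _|v]; first exact: differentiable_cst.
have -> : 'D_v (fun=> b) = (fun=> 0) :> (A -> B).
  by apply/funext => x; apply: derive_cst.
exact: IH.
Qed.

Lemma Ck_add (A B : normedModType R) k (U : set A) (h h' : A -> B) :
  open U -> Ck k U h -> Ck k U h' -> Ck k U (h + h').
Proof.
move=> oU; elim: k h h' => [|k IH] h h' /=.
  by move=> c c' x Ux; apply: continuousD; [apply: c|apply: c'].
move=> [d c] [d' c']; split=> [x Ux|v].
  by apply: differentiableD; [apply: d|apply: d'].
apply: (Ck_eq oU _ (IH _ _ (c v) (c' v))) => x Ux.
by rewrite deriveD //; apply: diff_derivable; [apply: d|apply: d'].
Qed.

Lemma Ck_mul (A : normedModType R) k (U : set A) (h h' : A -> R^o) :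
  open U -> Ck k U h -> Ck k U h' -> Ck k U (h * h').
Proof.
move=> oU; elim: k h h' => [|k IH] h h' ch ch'.
  by move=> x Ux; apply: continuousM; [apply: ch|apply: ch'].
have [d c] := ch; have [d' c'] := ch'; split=> [x Ux|v].
  by apply: differentiableM; [apply: d|apply: d'].
apply: (Ck_eq oU _ (Ck_add oU (IH _ _ (CkS ch) (c' v)) (IH _ _ (CkS ch') (c v)))).
move=> x Ux.
by rewrite deriveM //; apply: diff_derivable; [apply: d|apply: d'].
Qed.

Lemma Ck_sum (A B : normedModType R) k (U : set A) m (h : 'I_m -> A -> B) :
  open U -> (forall i, Ck k U (h i)) -> Ck k U (fun x => \sum_(i < m) h i x).
Proof.
move=> oU; elim: m h => [|m IH] h ch.
  by apply: (Ck_eq oU _ (@Ck_cst A B k U 0)) => x _; rewrite big_ord0.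
have c' := IH _ (fun i => ch (lift ord0 i)).
by apply: (Ck_eq oU _ (Ck_add oU (ch ord0) c')) => x _; rewrite big_ord_recl.
Qed.

Lemma derive_coord (A : normedModType R) m (g : A -> 'rV[R]_m) i x v :
  differentiable g x ->
  differentiable ((fun y => g y 0 i) : A -> R^o) x /\
  'D_v ((fun y => g y 0 i) : A -> R^o) x = 'D_v g x 0 i.
Proof.
move=> dg.
pose c0 (M : 'rV[R]_m) : R^o := M 0 i.
have lin : linear c0 by move=> a b c; rewrite /c0 !mxE.
pose cM := GRing.isLinear.Build _ _ _ _ _ lin.
pose c : {linear 'rV[R]_m -> R^o} := HB.pack c0 cM.
have cc : continuous c by apply: coord_continuous.
have dc y : differentiable c y by apply: linear_differentiable.
have -> : ((fun y => g y 0 i) : A -> R^o) = c \o g by [].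
split; first exact: differentiable_comp.
rewrite deriveE; last exact: differentiable_comp.
rewrite diff_comp //; transitivity ('d c (g x) ('d g x v)); first by [].
by rewrite diff_lin // deriveE.
Qed.

Lemma Ck_coord (A : normedModType R) k (U : set A) m (g : A -> 'rV[R]_m) i :
  open U -> Ck k U g -> Ck k U ((fun x => g x 0 i) : A -> R^o).
Proof.
move=> oU; elim: k g => [|k IH] g /=.
  move=> c x Ux; apply: (@continuous_comp _ _ _ g (fun M : 'rV[R]_m => M 0 i)).
    exact: c.
  exact: coord_continuous.
move=> [d c]; split=> [x Ux|v].
  by have [] := derive_coord i 0 (d _ Ux).
apply: (Ck_eq oU _ (IH _ (c v))) => x Ux.
by have [_ ->] := derive_coord i v (d _ Ux).
Qed.

Lemma derive_comp (A B C : normedModType R) (g : A -> B) (h : B -> C) x v :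
  differentiable g x -> differentiable h (g x) ->
  'D_v (h \o g) x = 'D_('D_v g x) h (g x).
Proof.
move=> dg dh; rewrite deriveE; last exact: differentiable_comp.
by rewrite diff_comp //= !deriveE.
Qed.

Lemma derive_row (B : normedModType R) m (h : 'rV[R]_m -> B) y w :
  differentiable h y ->
  'D_w h y = \sum_(i < m) w 0 i *: 'D_(delta_mx 0 i) h y.
Proof.
move=> dh; rewrite deriveE // {1}(row_sum_delta w) linear_sum.
by apply: eq_bigr => i _; rewrite linearZ deriveE.
Qed.

(** The derivative of [h \o g] along v is a derivative of h in a direction that varies with the
    point, whereas [Ck] speaks of constant directions only. Expanding that direction in the basis
    gives a sum of products, to which the induction hypothesis applies. *)
Lemma Ck_comp (A : normedModType R) k m (U : set A) (U' : set 'rV[R]_m)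
    (g : A -> 'rV[R]_m) (h : 'rV[R]_m -> R^o) :
  open U -> (forall x, U x -> U' (g x)) -> Ck k U g -> Ck k U' h ->
  Ck k U (h \o g).
Proof.
move=> oU gU; elim: k g h gU => [|k IH] g h gU cg ch.
  move=> x Ux; apply: continuous_comp; first exact: cg.
  by apply: ch; apply: gU.
have [dg cdg] := cg; have [dh cdh] := ch; split=> [x Ux|v].
  by apply: differentiable_comp; [apply: dg|apply/dh/gU].
have c' : Ck k U (fun x => \sum_(i < m)
    (((fun x => 'D_v g x 0 i : R^o) : A -> R^o) * ('D_(delta_mx 0 i) h \o g)) x).
  apply: Ck_sum => // i; apply: Ck_mul => //.
    exact: (Ck_coord i oU (cdg v)).
  by apply: IH gU _ _; [exact: CkS cg|exact: cdh].
apply: (Ck_eq oU _ c') => x Ux.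
rewrite derive_comp; [|exact: dg|exact/dh/gU].
by rewrite [RHS]derive_row //; apply/dh/gU.
Qed.

End Calculus.

(** * Charts and smooth maps *)

Section Charts.
Variable R : realType.

Section OneManifold.
Variables (n : nat) (M : manifold R n).
Implicit Types (p q r : M).

Definition chart_image p := coord (chart_at p) @` dom (chart_at p).

Lemma chart_dom_near p r : dom (chart_at p) r ->
  \forall q \near r, dom (chart_at p) q.
Proof. by move=> d; apply: open_nbhs_nbhs; split=> //; apply: open_dom. Qed.

Lemma chart_image_near p r : dom (chart_at p) r ->
  \forall x \near coord (chart_at p) r, chart_image p x.
Proof.
move=> d; apply: open_nbhs_nbhs; split; first exact: open_coord.
by exists r.
Qed.

Lemma chart_imageP p x : chart_image p x ->
  dom (chart_at p) (param (chart_at p) x) /\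
  coord (chart_at p) (param (chart_at p) x) = x.
Proof. by move=> [r d <-]; rewrite coordK. Qed.

Lemma near_param p r (P : M -> Prop) : dom (chart_at p) r ->
  (\forall q \near r, P q) ->
  \forall x \near coord (chart_at p) r, P (param (chart_at p) x).
Proof.
move=> d nP.
have c : {for coord (chart_at p) r, continuous (param (chart_at p))}.
  by apply: param_cont; exists r.
by apply: c; rewrite coordK.
Qed.

Lemma near_coord p r (P : 'rV[R]_n -> Prop) : dom (chart_at p) r ->
  (\forall x \near coord (chart_at p) r, P x) ->
  \forall q \near r, P (coord (chart_at p) q).
Proof. by move=> d nP; apply: (coord_cont d). Qed.

Lemma transition_differentiable p q r :
  dom (chart_at p) r -> dom (chart_at q) r ->
  differentiable (coord (chart_at q) \o param (chart_at p)) (coord (chart_at p) r).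
Proof.
move=> dp dq; have [d _] := chart_at_smooth p q 1.
by apply: d; exists r.
Qed.

Lemma chart_change (B : normedModType R) (h : M -> B) p q r v :
  dom (chart_at p) r -> dom (chart_at q) r ->
  differentiable (h \o param (chart_at p)) (coord (chart_at p) r) ->
  differentiable (h \o param (chart_at q)) (coord (chart_at q) r) /\
  'D_v (h \o param (chart_at q)) (coord (chart_at q) r) =
  'D_('D_v (coord (chart_at p) \o param (chart_at q)) (coord (chart_at q) r))
     (h \o param (chart_at p)) (coord (chart_at p) r).
Proof.
move=> dp dq dh.
have ne : {near coord (chart_at q) r,
    (h \o param (chart_at p)) \o (coord (chart_at p) \o param (chart_at q)) =1
    h \o param (chart_at q)}.
  apply: (near_param dq (P := fun s => h (param (chart_at p) (coord (chart_at p) s)) = h s)).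
  by apply: filterS (chart_dom_near dp) => s ds; rewrite coordK.
have dt := transition_differentiable dq dp.
have E : (coord (chart_at p) \o param (chart_at q)) (coord (chart_at q) r) =
   coord (chart_at p) r by rewrite /= coordK.
have dh' : differentiable (h \o param (chart_at p))
  ((coord (chart_at p) \o param (chart_at q)) (coord (chart_at q) r)) by rewrite E.
split; first by apply: near_eq_differentiable ne _; apply: differentiable_comp.
by rewrite -(near_eq_derive _ ne) derive_comp // E.
Qed.

Lemma smooth_at_eq (B : normedModType R) (h h' : M -> B) p :
  (\forall q \near p, h q = h' q) -> smooth_at h p -> smooth_at h' p.
Proof.
move=> e [U [oU Up Us cU]].
have /(near_param (chart_at_dom p)) := e.
rewrite /prop_near1 nbhsE => -[Z [oO Op] sO].
exists (U `&` Z); split=> //; first exact: openI.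
  by move=> x [Ux _]; apply: Us.
move=> k; apply: (@Ck_eq _ _ _ k (U `&` Z) (h \o param (chart_at p))).
- exact: openI.
- by move=> x [_ /sO].
- by apply: Ck_sub (cU k) => x [].
Qed.

Lemma smooth_fun_differentiable (h : M -> R) p : smooth_fun_at h p ->
  \forall q \near p, dom (chart_at p) q /\
    differentiable ((h : M -> R^o) \o param (chart_at p)) (coord (chart_at p) q).
Proof.
move=> [U [oU Up Us cU]].
have nU : \forall x \near coord (chart_at p) p, U x by apply: open_nbhs_nbhs.
have nU' := near_coord (chart_at_dom p) nU.
have nd := chart_dom_near (chart_at_dom p).
near=> q; split; first by near: q.
by have [d _] := cU 1; apply: d; near: q.
Unshelve. all: by end_near. Qed.

Lemma smooth_fun_diff (h : M -> R) p : smooth_fun_at h p ->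
  differentiable ((h : M -> R^o) \o param (chart_at p)) (coord (chart_at p) p).
Proof. by move=> /smooth_fun_differentiable/nbhs_singleton[]. Qed.

Lemma smooth_fun_cst (a : R) p : smooth_fun_at (fun=> a) p.
Proof.
exists (chart_image p); split=> //; first exact: open_coord.
- by exists p => //; apply: chart_at_dom.
- by move=> k; apply: Ck_cst.
Qed.

Lemma smooth_fun_add (h h' : M -> R) p : smooth_fun_at h p ->
  smooth_fun_at h' p -> smooth_fun_at (fun q => h q + h' q) p.
Proof.
move=> [U [oU Up Us cU]] [U' [oU' Up' _ cU']].
have oI := openI oU oU'.
exists (U `&` U'); split=> //; first by move=> x [Ux _]; apply: Us.
move=> k; apply: (Ck_add oI (h := (h : M -> R^o) \o _) (h' := (h' : M -> R^o) \o _)).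
  by apply: Ck_sub (cU k) => x [].
by apply: Ck_sub (cU' k) => x [].
Qed.

Lemma smooth_fun_mul (h h' : M -> R) p : smooth_fun_at h p ->
  smooth_fun_at h' p -> smooth_fun_at (fun q => h q * h' q) p.
Proof.
move=> [U [oU Up Us cU]] [U' [oU' Up' _ cU']].
have oI := openI oU oU'.
exists (U `&` U'); split=> //; first by move=> x [Ux _]; apply: Us.
move=> k; apply: (Ck_mul oI (h := (h : M -> R^o) \o _) (h' := (h' : M -> R^o) \o _)).
  by apply: Ck_sub (cU k) => x [].
by apply: Ck_sub (cU' k) => x [].
Qed.

Lemma dirder_cst p v (a : R) : dirder p v (fun=> a) = 0.
Proof. exact: derive_cst. Qed.

(* The vector field with constant coordinates x in the preferred chart at p,
   expressed at q in the preferred chart at q. *)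
Definition coord_field p (x : 'rV[R]_n) q : 'rV[R]_n :=
  'D_x (coord (chart_at q) \o param (chart_at p)) (coord (chart_at p) q).

Lemma coord_field_center p x : coord_field p x p = x.
Proof.
rewrite /coord_field (@near_eq_derive _ _ _ _ id) ?derive_id //.
by apply: filterS (chart_image_near (chart_at_dom p)) => y /chart_imageP[].
Qed.

Lemma dirder_coord_field p x q (h : M -> R) : dom (chart_at p) q ->
  differentiable ((h : M -> R^o) \o param (chart_at p)) (coord (chart_at p) q) ->
  dirder q (coord_field p x q) h =
  'D_x ((h : M -> R^o) \o param (chart_at p)) (coord (chart_at p) q).
Proof.
move=> d dh; have [dq _] := chart_change 0 d (chart_at_dom q) dh.
by have [_ ->] := chart_change x (chart_at_dom q) d dq.
Qed.

(** In the chart at p, deriving along this field is a partial derivative, and order k + 1 of [Ck]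
    controls it at order k. *)
Lemma coord_field_smooth p x : smooth_sec (coord_field p x : forall q, tangent M q) p.
Proof.
move=> h hs.
have [U [oU Up Us cU]] := hs.
have nd := smooth_fun_differentiable hs.
apply: (@smooth_at_eq R^o
  (fun q => 'D_x ((h : M -> R^o) \o param (chart_at p)) (coord (chart_at p) q))).
  by apply: filterS nd => q [d dh]; rewrite dirder_coord_field.
exists U; split=> // k.
apply: (@Ck_eq _ _ _ k U ('D_x ((h : M -> R^o) \o param (chart_at p)))) => //.
  by move=> y /Us/chart_imageP[_ E]; rewrite /comp E.
by have [_] := cU k.+1; apply.
Qed.

End OneManifold.

(** * Smooth maps and the push-forward of tangent vectors *)

Section Maps.
Variables (m n : nat) (M : manifold R m) (N : manifold R n) (f : M -> N).
Hypothesis fs : smooth_map f.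

Lemma near_smooth_map p (P : N -> Prop) :
  (\forall y \near f p, P y) -> \forall q \near p, P (f q).
Proof. by have [c _] := fs; apply: c. Qed.

Lemma chart_map_differentiable p :
  differentiable (coord (chart_at (f p)) \o f \o param (chart_at p))
    (coord (chart_at p) p).
Proof.
have [_ /(_ p)[U [_ Up _ cU]]] := fs.
by have [d _] := cU 1; apply: d.
Qed.

Lemma derive_dmap p v :
  'D_v (coord (chart_at (f p)) \o f \o param (chart_at p)) (coord (chart_at p) p) =
  v *m dmap f p.
Proof. by rewrite deriveEjacobian //; apply: chart_map_differentiable. Qed.

Lemma derive_comp_map (B : normedModType R) (h : N -> B) p v :
  differentiable (h \o param (chart_at (f p))) (coord (chart_at (f p)) (f p)) ->
  differentiable (h \o f \o param (chart_at p)) (coord (chart_at p) p) /\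
  'D_v (h \o f \o param (chart_at p)) (coord (chart_at p) p) =
  'D_(v *m dmap f p) (h \o param (chart_at (f p))) (coord (chart_at (f p)) (f p)).
Proof.
move=> dh; have d := chart_map_differentiable p.
have ne : {near coord (chart_at p) p,
   (h \o param (chart_at (f p))) \o (coord (chart_at (f p)) \o f \o param (chart_at p)) =1
   h \o f \o param (chart_at p)}.
  apply: (near_param (chart_at_dom p) (P := fun s =>
     h (param (chart_at (f p)) (coord (chart_at (f p)) (f s))) = h (f s))).
  by apply: filterS (near_smooth_map (chart_dom_near (chart_at_dom (f p)))) => s ds; rewrite coordK.
have E : (coord (chart_at (f p)) \o f \o param (chart_at p)) (coord (chart_at p) p) =
   coord (chart_at (f p)) (f p).
  by rewrite /= coordK //; apply: chart_at_dom.
have dh' : differentiable (h \o param (chart_at (f p)))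
   ((coord (chart_at (f p)) \o f \o param (chart_at p)) (coord (chart_at p) p)) by rewrite E.
split; first by apply: near_eq_differentiable ne _; apply: differentiable_comp.
by rewrite -(near_eq_derive _ ne) derive_comp // E derive_dmap.
Qed.

Lemma dirder_comp_map (h : N -> R) p v : smooth_fun_at h (f p) ->
  dirder p v (h \o f) = dirder (f p) (v *m dmap f p) h.
Proof.
move=> /smooth_fun_diff dh.
by have [_] := derive_comp_map v dh.
Qed.

Lemma smooth_fun_comp (h : N -> R) p : smooth_fun_at h (f p) ->
  smooth_fun_at (h \o f) p.
Proof.
move=> [U [oU Up Us cU]].
have [_ /(_ p)[U' [oU' Up' Us' cU']]] := fs.
pose g := coord (chart_at (f p)) \o f \o param (chart_at p).
pose good q := dom (chart_at (f p)) (f q) /\ U (coord (chart_at (f p)) (f q)).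
have ng : \forall q \near p, good q.
  apply: (near_smooth_map (P := fun y => dom (chart_at (f p)) y /\ U (coord (chart_at (f p)) y))).
  apply: filterI; first exact/chart_dom_near/chart_at_dom.
  by apply: (near_coord (chart_at_dom (f p))); apply: open_nbhs_nbhs.
have := near_param (chart_at_dom p) ng.
rewrite /prop_near1 nbhsE => -[Z [oZ Zp] sZ].
have oI : open (U' `&` Z) by apply: openI.
exists (U' `&` Z); split=> //; first by move=> x [U'x _]; apply: Us'.
move=> k.
apply: (@Ck_eq _ _ _ k _ (((h : N -> R^o) \o param (chart_at (f p))) \o g)) => //.
  by move=> x [_ /sZ[dx _]]; rewrite /g /= coordK.
apply: (@Ck_comp _ _ k n _ U) => //.
  by move=> x [_ /sZ[_]].
by apply: Ck_sub (cU' k) => x [].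
Qed.

Lemma smooth_coord_fun (p : N) i :
  smooth_fun_at (fun q => coord (chart_at p) q 0 i) p.
Proof.
have [U [oU Up Us cU]] : smooth_at (coord (chart_at p)) p.
  have o : open (chart_image p) by apply: open_coord.
  exists (chart_image p); split=> //; first by exists p => //; apply: chart_at_dom.
  move=> k; have := chart_at_smooth p p k; rewrite setIid; exact.
by exists U; split=> // k; apply: (Ck_coord i oU (cU k)).
Qed.

(** The coefficients are the derivatives of the coordinates of [f]. This is the shape that a smooth
    section of the pullback must have, and it makes the push-forward of a smooth tangent field
    smooth along [f]. *)
Lemma mul_dmap_expansion p q v : dom (chart_at (f p)) (f q) ->
  v *m dmap f q = \sum_(i < n)
    dirder q v ((fun y => coord (chart_at (f p)) y 0 i) \o f) *:
    coord_field (f p) (delta_mx 0 i) (f q).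
Proof.
move=> d.
have dt := transition_differentiable (chart_at_dom (f q)) d.
have [dg Dg] := derive_comp_map (h := coord (chart_at (f p))) v dt.
(* w is the push-forward of v read in the chart at [f p], which stays fixed when q varies;
   [v *m dmap f q] is the same vector read in the chart at [f q]. *)
pose w := 'D_v (coord (chart_at (f p)) \o f \o param (chart_at q)) (coord (chart_at q) q).
have -> : v *m dmap f q = coord_field (f p) w (f q).
  have dt' := transition_differentiable d (chart_at_dom (f q)).
  have [_ E] := chart_change (v *m dmap f q) d (chart_at_dom (f q)) dt'.
  rewrite /coord_field /w Dg -E.
  exact/esym/(coord_field_center (f q) (v *m dmap f q)).
transitivity (\sum_(i < n) w 0 i *: coord_field (f p) (delta_mx 0 i) (f q)).
  apply: derive_row; exact: transition_differentiable d (chart_at_dom (f q)).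
apply: eq_bigr => i _; congr (_ *: _).
have [_ E] := derive_coord i v dg.
exact/esym/E.
Qed.

Lemma mul_dmap_smooth p (X : forall q, tangent M q) :
  smooth_sec X p ->
  smooth_sec ((fun q => X q *m dmap f q) : forall q, pullback f (tangent N) q) p.
Proof.
move=> Xs.
exists n, (fun i q => dirder q (X q) ((fun y => coord (chart_at (f p)) y 0 i) \o f)).
exists (fun i => coord_field (f p) (delta_mx 0 i)); split.
- by move=> i; apply/Xs/smooth_fun_comp/smooth_coord_fun.
- by move=> i; apply: coord_field_smooth.
- have := near_smooth_map (chart_dom_near (chart_at_dom (f p))).
  by apply: filterS => q d; apply: mul_dmap_expansion.
Qed.

End Maps.
End Charts.

(** * Bundles and connections *)

Section Connections.
Variable R : realType.

Lemma connection0 n (M : manifold R n) (E : bundle M) (D : connection E) p v :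
  smooth_sec (fun q => 0 : E q) p -> D p v (fun q => 0 : E q) = 0.
Proof.
move=> s0.
have E0 : (fun q => 0 : E q) = (fun q => (0 : R) *: (0 : E q)).
  by apply: functional_extensionality_dep => q; rewrite scaler0.
rewrite {1}E0 (nabla_leibniz D v (smooth_fun_cst _ p) s0).
by rewrite dirder_cst !scale0r addr0.
Qed.

(** * Tensorial operators on sections of a vector bundle *)

Section VectorBundle.
Variables (n : nat) (N : manifold R n) (r : nat) (E : bundle N).
Hypothesis Ev : vector_bundle r E.
Implicit Type y : N.

Lemma vb_add y (s t : forall q, E q) : smooth_sec s y -> smooth_sec t y ->
  smooth_sec (fun q => s q + t q) y.
Proof.
have [e [_ _ H]] := Ev y.
move=> /H[a sa ea] /H[b sb eb]; apply/H; exists (fun i q => a i q + b i q).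
  by move=> i; apply: smooth_fun_add.
apply: filterS2 ea eb => q -> ->; rewrite -big_split /=.
by apply: eq_bigr => i _; rewrite scalerDl.
Qed.

Lemma vb_scale y (h : N -> R) (s : forall q, E q) : smooth_fun_at h y ->
  smooth_sec s y -> smooth_sec (fun q => h q *: s q) y.
Proof.
have [e [_ _ H]] := Ev y.
move=> sh /H[a sa ea]; apply/H; exists (fun i q => h q * a i q).
  by move=> i; apply: smooth_fun_mul.
apply: filterS ea => q ->; rewrite scaler_sumr.
by apply: eq_bigr => i _; rewrite scalerA.
Qed.

Lemma vb_zero y : smooth_sec (fun q => 0 : E q) y.
Proof.
have [e [_ _ H]] := Ev y.
apply/H; exists (fun i q => 0); first by move=> i; apply: smooth_fun_cst.
by apply: filterE => q; rewrite big1 // => i _; rewrite scale0r.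
Qed.

Lemma vb_extend y (x : E y) : exists2 s : forall q, E q, smooth_sec s y & s y = x.
Proof.
have [e [/nbhs_singleton b _ H]] := Ev y.
have [a [-> _]] := b x.
exists (fun q => \sum_(i < r) a i *: e i q) => //.
apply/H; exists (fun i _ => a i); first by move=> i; apply: smooth_fun_cst.
exact: filterE.
Qed.

Lemma vb_basis y : exists e : 'I_r -> E y, forall x : E y,
  exists! a : 'I_r -> R, x = \sum_(i < r) a i *: e i.
Proof.
have [e [/nbhs_singleton b _ H]] := Ev y.
by exists (fun i => e i y).
Qed.

Section Tensor.
Variables (y : N) (F : lmodType R) (T : (forall q, E q) -> F).
Hypothesis Tadd : forall s t : forall q, E q, smooth_sec s y -> smooth_sec t y ->
  T (fun q => s q + t q) = T s + T t.
Hypothesis Tscale : forall (h : N -> R) (s : forall q, E q), smooth_fun_at h y ->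
  smooth_sec s y -> T (fun q => h q *: s q) = h y *: T s.
Hypothesis Tloc : forall s t : forall q, E q, smooth_sec s y -> smooth_sec t y ->
  (\forall q \near y, s q = t q) -> T s = T t.

(** Near y the section is a combination of a local frame, and its coefficients vanish at y by
    uniqueness; T is linear over functions, so it sees these coefficients only through their values
    at y. *)
Lemma tensor_vanish (s : forall q, E q) : smooth_sec s y -> s y = 0 -> T s = 0.
Proof.
move=> ss s0.
have [e [b es H]] := Ev y.
have [a sa ea] := (H s).1 ss.
have T0 : T (fun q => 0) = 0.
  have E0 : (fun q => 0 : E q) = (fun q => (0 : R) *: (0 : E q)).
    by apply: functional_extensionality_dep => q; rewrite scaler0.
  by rewrite E0 (Tscale (smooth_fun_cst _ _)) ?scale0r //; apply: vb_zero.
have es' i : smooth_sec (e i) y := nbhs_singleton (es i).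
have S (l : seq 'I_r) : smooth_sec (fun q => \sum_(i <- l) a i q *: e i q) y /\
    T (fun q => \sum_(i <- l) a i q *: e i q) = \sum_(i <- l) a i y *: T (e i).
  elim: l => [|i l [sl El]].
    have -> : (fun q => \sum_(i <- [::]) a i q *: e i q) = (fun q => 0).
      by apply: functional_extensionality_dep => q; rewrite big_nil.
    by rewrite big_nil; split=> //; apply: vb_zero.
  have -> : (fun q => \sum_(i <- i :: l) a i q *: e i q) =
      (fun q => a i q *: e i q + \sum_(i <- l) a i q *: e i q).
    by apply: functional_extensionality_dep => q; rewrite big_cons.
  have si := vb_scale (sa i) (es' i).
  split; first exact: vb_add.
  by rewrite Tadd // Tscale // El big_cons.
have [sS ES] := S (index_enum 'I_r).
rewrite (Tloc ss sS ea) ES.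
have z i : a i y = 0.
  have [c [_ u]] := nbhs_singleton b 0.
  have /u Ea : 0 = \sum_(i < r) a i y *: e i y by rewrite -(nbhs_singleton ea).
  have /u E0 : 0 = \sum_(i < r) (0 : R) *: e i y.
    by rewrite big1 // => k _; rewrite scale0r.
  by have := congr1 (fun h => h i) (etrans (esym Ea) E0).
by rewrite big1 // => i _; rewrite z scale0r.
Qed.

Lemma tensor_fibre : exists L : E y -> F,
  (forall a x z, L (a *: x + z) = a *: L x + L z) /\
  forall s, smooth_sec s y -> T s = L (s y).
Proof.
have TZD a s t : smooth_sec s y -> smooth_sec t y ->
    smooth_sec (fun q => a *: s q + t q) y /\
    T (fun q => a *: s q + t q) = a *: T s + T t.
  move=> ss st; have sa := vb_scale (smooth_fun_cst a y) ss.
  by split; [exact: vb_add|rewrite Tadd // (Tscale (smooth_fun_cst a y))].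
have wd s t : smooth_sec s y -> smooth_sec t y -> s y = t y -> T s = T t.
  move=> ss st e; apply/eqP; rewrite -subr_eq0; apply/eqP.
  have [su Eu] := TZD (-1) t s st ss.
  apply: etrans (tensor_vanish su _); first by rewrite Eu scaleN1r addrC.
  by rewrite scaleN1r e addNr.
(* Any extension of a fibre vector to a section will do, as T depends on the value at y only. *)
pose ext (x : E y) := s2val (cid2 (vb_extend x)).
have exts x : smooth_sec (ext x) y by rewrite /ext; case: cid2.
have extE x : ext x y = x by rewrite /ext; case: cid2.
exists (fun x => T (ext x)); split.
  move=> a x z.
  have [su Eu] := TZD a _ _ (exts x) (exts z).
  by rewrite -Eu; apply: wd => //; rewrite !extE.
by move=> s ss; apply: wd => //; rewrite extE.
Qed.

End Tensor.
End VectorBundle.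

(** * Sections along a map, and the connection pulled back from the target *)

Section Pullback.
Variables (m n : nat) (M : manifold R m) (N : manifold R n) (f : M -> N).

Section OneBundle.
Variable E : bundle N.

Lemma pb_eq p (s t : forall q, pullback f E q) : (\forall q \near p, s q = t q) ->
  smooth_sec s p -> smooth_sec t p.
Proof.
move=> e [k [a [u [sa su es]]]]; exists k, a, u; split=> //.
by apply: filterS2 e es => q ->.
Qed.

Lemma pb_zero p : smooth_sec (fun q => 0 : pullback f E q) p.
Proof.
exists 0, (fun i q => 0), (fun i q => 0); split; [by case|by case|].
by apply: filterE => q; rewrite big_ord0.
Qed.

Lemma pb_cons p (h : M -> R) (t : forall q, E q) (s : forall q, pullback f E q) :
  smooth_fun_at h p -> smooth_sec t (f p) -> smooth_sec s p ->
  smooth_sec (fun q => h q *: t (f q) + s q : pullback f E q) p.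
Proof.
move=> sh st [k [a [u [sa su es]]]].
exists k.+1, (fun i => if unlift ord0 i is Some i' then a i' else h).
exists (fun i => if unlift ord0 i is Some i' then u i' else t); split.
- by move=> i; case: unliftP.
- by move=> i; case: unliftP.
- apply: filterS es => q ->; rewrite big_ord_recl unlift_none.
  by congr (_ + _); apply: eq_bigr => i _; rewrite liftK.
Qed.

Lemma pb_comp p (t : forall q, E q) : smooth_sec t (f p) ->
  smooth_sec (fun q => t (f q) : pullback f E q) p.
Proof.
move=> st; apply: pb_eq (pb_cons (smooth_fun_cst 1 p) st (pb_zero p)).
by apply: filterE => q; rewrite scale1r addr0.
Qed.

(** Sections along [f] need not be restrictions [t \o f], but locally they are built from 0 by
    adding terms h (t \o f). This induction carries statements known over N to fields such as the
    unit normal, which is given over M alone. *)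
Lemma pb_ind p (P : (forall q, pullback f E q) -> Prop) :
  (forall s t : forall q, pullback f E q, smooth_sec s p -> smooth_sec t p ->
     (\forall q \near p, s q = t q) -> P s -> P t) ->
  P (fun q => 0) ->
  (forall h t s, smooth_fun_at h p -> smooth_sec t (f p) ->
     @smooth_sec _ _ _ (pullback f E) s p -> P s ->
     P (fun q => h q *: t (f q) + s q)) ->
  forall s, smooth_sec s p -> P s.
Proof.
move=> Ploc P0 Pcons s ss; have [k [a [u [sa su es]]]] := ss.
have S (l : seq 'I_k) :
    smooth_sec (fun q => \sum_(i <- l) a i q *: u i (f q) : pullback f E q) p /\
    P (fun q => \sum_(i <- l) a i q *: u i (f q)).
  elim: l => [|i l [sl Pl]].
    have -> : (fun q => \sum_(i <- [::]) a i q *: u i (f q)) = (fun q => 0).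
      by apply: functional_extensionality_dep => q; rewrite big_nil.
    by split=> //; apply: pb_zero.
  have -> : (fun q => \sum_(i <- i :: l) a i q *: u i (f q)) =
      (fun q => a i q *: u i (f q) + \sum_(i <- l) a i q *: u i (f q)).
    by apply: functional_extensionality_dep => q; rewrite big_cons.
  by split; [apply: pb_cons|apply: Pcons].
have [sS PS] := S (index_enum 'I_k).
by apply: Ploc sS ss _ PS; apply: filterS es => q ->.
Qed.

Lemma pb_scale p (h : M -> R) (s : forall q, pullback f E q) :
  smooth_fun_at h p -> smooth_sec s p ->
  smooth_sec (fun q => h q *: s q : pullback f E q) p.
Proof.
move=> sh [k [a [u [sa su es]]]].
exists k, (fun i q => h q * a i q), u; split=> //.
  by move=> i; apply: smooth_fun_mul.
apply: filterS es => q ->; rewrite scaler_sumr.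
by apply: eq_bigr => i _; rewrite scalerA.
Qed.

Lemma pb_add p (s t : forall q, pullback f E q) :
  smooth_sec s p -> smooth_sec t p ->
  smooth_sec (fun q => s q + t q : pullback f E q) p.
Proof.
move=> ss st; move: s ss; apply: pb_ind.
- move=> s s' _ _ e; apply: pb_eq.
  by apply: filterS e => q ->.
- by apply: pb_eq st; apply: filterE => q; rewrite add0r.
- move=> h u s sh su ss; move=> /(pb_cons sh su); apply: pb_eq.
  by apply: filterE => q; rewrite addrA.
Qed.

End OneBundle.

Hypothesis fs : smooth_map f.
Variables (E : bundle N) (r : nat) (Ev : vector_bundle r E).
Variables (DE : connection E) (DS : connection (pullback f E)).
Variables (p : M) (v : 'rV[R]_m).

(** The Leibniz terms of the two derivatives agree, since the derivative of [h \o f] along v is that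
    of h along the push-forward of v. They cancel in the difference, which is therefore an
    endomorphism of the fibre. *)
Lemma connection_difference : exists L : E (f p) -> E (f p),
  (forall a x z, L (a *: x + z) = a *: L x + L z) /\
  forall s, smooth_sec s (f p) ->
    DS p v (fun q => s (f q)) = DE (f p) (v *m dmap f p) s + L (s (f p)).
Proof.
pose T (s : forall q, E q) : E (f p) :=
  DS p v (fun q => s (f q)) - DE (f p) (v *m dmap f p) s.
have [||| L [Llin LT]] := @tensor_fibre _ _ _ _ Ev (f p) _ T.
- move=> s t ss st; rewrite /T nabla_add //.
  have := nabla_add DS v (pb_comp ss) (pb_comp st) => ->.
  by rewrite opprD addrACA.
- move=> h s sh ss; rewrite /T nabla_leibniz //.
  have := nabla_leibniz DS v (smooth_fun_comp fs sh) (pb_comp ss) => ->.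
  by rewrite (dirder_comp_map fs _ sh) scalerBr opprD addrACA subrr add0r.
- move=> s t ss st e; rewrite /T (nabla_local DE _ ss st e); congr (_ - _).
  exact: (nabla_local DS v (pb_comp ss) (pb_comp st) (near_smooth_map fs e)).
exists L; split=> // s ss; rewrite -LT // /T addrC subrK //.
Qed.

Variable c : forall y : N, 'rV[R]_n -> E y -> E y.
Hypothesis c_linl : forall y (a : R) (w z : 'rV[R]_n) (x : E y),
  c (a *: w + z) x = a *: c w x + c z x.
Hypothesis c_linr : forall y (a : R) (w : 'rV[R]_n) (x z : E y),
  c w (a *: x + z) = a *: c w x + c w z.
Hypothesis c_smooth : forall (X : forall q, tangent N q) (s : forall q, E q) y,
  smooth_sec X y -> smooth_sec s y -> smooth_sec (fun q => c (X q) (s q)) y.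
Variables (DN : connection (tangent N)) (DNf : connection (pullback f (tangent N))).
Hypothesis hDNf : pullback_connection DN DNf.
Hypothesis c_parallel : forall (y : N) (w : 'rV[R]_n) (X : forall q, tangent N q)
    (s : forall q, E q), smooth_sec X y -> smooth_sec s y ->
  DE y w (fun q => c (X q) (s q)) = c (DN y w X) (s y) + c (X y) (DE y w s).
Variable L : E (f p) -> E (f p).
Hypothesis L_lin : forall a x z, L (a *: x + z) = a *: L x + L z.
Hypothesis LE : forall s, smooth_sec s (f p) ->
  DS p v (fun q => s (f q)) = DE (f p) (v *m dmap f p) s + L (s (f p)).

Let c0l y (x : E y) : c 0 x = 0.
Proof.
by have := c_linl (-1) 0 0 x; rewrite scaler0 add0r scaleN1r addNr.
Qed.

Let c0r y w : c w (0 : E y) = 0.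
Proof.
by have := c_linr (-1) w (0 : E y) 0; rewrite scaler0 add0r scaleN1r addNr.
Qed.

Let L0 : L 0 = 0.
Proof.
by have := L_lin (-1) 0 0; rewrite scaler0 add0r scaleN1r addNr.
Qed.

(* As L is the difference to DS, this is the connection pulled back from E. *)
Definition pb_nabla (s : forall q, pullback f E q) : E (f p) :=
  DS p v s - L (s p).

Lemma pb_nabla0 : pb_nabla (fun q => 0) = 0.
Proof. by rewrite /pb_nabla L0 subr0; exact: (connection0 DS v (@pb_zero E p)). Qed.

Lemma pb_nabla_comp s : smooth_sec s (f p) ->
  pb_nabla (fun q => s (f q)) = DE (f p) (v *m dmap f p) s.
Proof. by move=> ss; rewrite /pb_nabla LE // addrK. Qed.

Lemma pb_nabla_loc (s t : forall q, pullback f E q) :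
  smooth_sec s p -> smooth_sec t p -> (\forall q \near p, s q = t q) ->
  pb_nabla s = pb_nabla t.
Proof.
move=> ss st e.
by rewrite /pb_nabla (nabla_local DS v ss st e) (nbhs_singleton e).
Qed.

Lemma pb_nabla_add (s t : forall q, pullback f E q) :
  smooth_sec s p -> smooth_sec t p ->
  pb_nabla (fun q => s q + t q) = pb_nabla s + pb_nabla t.
Proof.
move=> ss st; rewrite /pb_nabla (nabla_add DS v ss st).
have := L_lin 1 (s p) (t p); rewrite !scale1r => ->.
by rewrite opprD addrACA.
Qed.

Lemma pb_nabla_scale (h : M -> R) (s : forall q, pullback f E q) :
  smooth_fun_at h p -> smooth_sec s p ->
  pb_nabla (fun q => h q *: s q) = dirder p v h *: s p + h p *: pb_nabla s.
Proof.
move=> sh ss; rewrite /pb_nabla (nabla_leibniz DS v sh ss).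
have := L_lin (h p) (s p) 0; rewrite L0 !addr0 => ->.
by rewrite scalerBr addrA.
Qed.

Lemma pb_nabla_cons (h : M -> R) (t : forall q, E q) (s : forall q, pullback f E q) :
  smooth_fun_at h p -> smooth_sec t (f p) -> smooth_sec s p ->
  pb_nabla (fun q => h q *: t (f q) + s q) =
  dirder p v h *: t (f p) + h p *: DE (f p) (v *m dmap f p) t + pb_nabla s.
Proof.
move=> sh st ss; have st' := pb_comp st.
rewrite (pb_nabla_add (pb_scale sh st') ss).
by rewrite (pb_nabla_scale sh st') pb_nabla_comp.
Qed.

Lemma pb_nabla_cliff_comp (t : forall q, tangent N q) (s : forall q, pullback f E q) :
  smooth_sec t (f p) -> smooth_sec s p ->
  smooth_sec (fun q => c (t (f q)) (s q) : pullback f E q) p /\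
  pb_nabla (fun q => c (t (f q)) (s q)) =
    c (DN (f p) (v *m dmap f p) t) (s p) + c (t (f p)) (pb_nabla s).
Proof.
move=> st; move: s; apply: pb_ind.
- move=> s s' ss ss' e [sc Ec].
  have e' : \forall q \near p, c (t (f q)) (s q) = c (t (f q)) (s' q).
    by apply: filterS e => q ->.
  have sc' := pb_eq (E := E) e' sc.
  by split=> //; rewrite -(pb_nabla_loc sc sc' e') Ec (nbhs_singleton e) (pb_nabla_loc ss ss' e).
- have -> : (fun q => c (t (f q)) (0 : E (f q))) = (fun q => 0).
    by apply: functional_extensionality_dep => q; rewrite c0r.
  by rewrite pb_nabla0 !c0r addr0; split=> //; apply: pb_zero.
- move=> h u s sh su ss [sc Ec].
  have -> : (fun q => c (t (f q)) (h q *: u (f q) + s q)) =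
      (fun q => h q *: c (t (f q)) (u (f q)) + c (t (f q)) (s q)).
    by apply: functional_extensionality_dep => q; rewrite c_linr.
  have sw := c_smooth st su.
  have sc' := pb_cons sh sw sc.
  split=> //; rewrite (pb_nabla_cons sh sw sc) (pb_nabla_cons sh su ss) Ec.
  rewrite c_parallel // c_linr -(addrA (dirder p v h *: u (f p))) !c_linr scalerDr.
  by rewrite (addrCA (dirder p v h *: _)) [LHS]addrACA -!addrA.
Qed.

(** Parallelism of Clifford multiplication along [f]. Over N it is known for restricted sections;
    one induction frees the spinor field, in [pb_nabla_cliff_comp], and a second one the vector
    field. *)
Lemma pb_nabla_cliff (Y : forall q, pullback f (tangent N) q)
    (s : forall q, pullback f E q) : smooth_sec Y p -> smooth_sec s p ->
  smooth_sec (fun q => c (Y q) (s q) : pullback f E q) p /\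
  pb_nabla (fun q => c (Y q) (s q)) =
    c (DNf p v Y) (s p) + c (Y p) (pb_nabla s).
Proof.
move=> sY ss; move: Y sY; apply: pb_ind.
- move=> Y Y' sY sY' e [sc Ec].
  have e' : \forall q \near p, c (Y q) (s q) = c (Y' q) (s q).
    by apply: filterS e => q ->.
  have sc' := pb_eq (E := E) e' sc.
  split=> //; rewrite -(pb_nabla_loc sc sc' e') Ec (nbhs_singleton e).
  by rewrite (nabla_local DNf v sY sY' e).
- have -> : (fun q => c 0 (s q)) = (fun q => 0).
    by apply: functional_extensionality_dep => q; rewrite c0l.
  rewrite pb_nabla0 (connection0 DNf) ?c0l ?addr0; first by split=> //; apply: pb_zero.
  exact: pb_zero.
- move=> h t Y sh st sY [sc Ec].
  have -> : (fun q => c (h q *: t (f q) + Y q) (s q)) =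
      (fun q => h q *: c (t (f q)) (s q) + c (Y q) (s q)).
    by apply: functional_extensionality_dep => q; rewrite c_linl.
  have [sw Ew] := pb_nabla_cliff_comp st ss.
  have st' := pb_comp st.
  split; first exact: (pb_add (pb_scale sh sw) sc).
  rewrite (pb_nabla_add (pb_scale sh sw) sc) (pb_nabla_scale sh sw) Ew Ec.
  rewrite (nabla_add DNf v (pb_scale sh st') sY) (nabla_leibniz DNf v sh st').
  rewrite hDNf // c_linl -(addrA (dirder p v h *: t (f p))) !c_linl scalerDr.
  by rewrite (addrA (dirder p v h *: _)) [LHS]addrACA -!addrA.
Qed.

End Pullback.
End Connections.

(** * Inner products *)

Section Form.
Variables (R : realType) (E : lmodType R) (g : E -> E -> R).
Hypothesis g_lin : forall a x y z, g (a *: x + y) z = a * g x z + g y z.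
Hypothesis g_sym : forall x y, g x y = g y x.
Hypothesis g_pos : forall x, x <> 0 -> 0 < g x x.
Lemma form0l x : g 0 x = 0.
Proof. by have := g_lin (-1) 0 0 x; rewrite scaler0 add0r mulN1r addNr. Qed.
Lemma formDl x y z : g (x + y) z = g x z + g y z.
Proof. by have := g_lin 1 x y z; rewrite scale1r mul1r. Qed.
Lemma formZl a x z : g (a *: x) z = a * g x z.
Proof. by have := g_lin a x 0 z; rewrite addr0 form0l addr0. Qed.
Lemma formNl x z : g (- x) z = - g x z.
Proof. by rewrite -scaleN1r formZl mulN1r. Qed.
Lemma formDr x y z : g x (y + z) = g x y + g x z.
Proof. by rewrite g_sym formDl !(g_sym x). Qed.
Lemma formZr a x z : g x (a *: z) = a * g x z.
Proof. by rewrite g_sym formZl g_sym. Qed.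
Lemma formNr x z : g x (- z) = - g x z.
Proof. by rewrite g_sym formNl g_sym. Qed.
Lemma form0r x : g x 0 = 0. Proof. by rewrite g_sym form0l. Qed.
Lemma form_suml (I : Type) (l : seq I) (x : I -> E) z :
  g (\sum_(i <- l) x i) z = \sum_(i <- l) g (x i) z.
Proof.
by elim: l => [|i l IH]; rewrite ?big_nil ?form0l // !big_cons formDl IH.
Qed.

Lemma form_eq0 x : g x x = 0 -> x = 0.
Proof. by move=> e; apply/eqP; case: eqP => // /g_pos; rewrite e ltxx. Qed.

Lemma form_ext x y : (forall z, g x z = g y z) -> x = y.
Proof.
move=> e; apply/eqP; rewrite -subr_eq0; apply/eqP/form_eq0.
by rewrite formDl formNl e subrr.
Qed.

End Form.

Section InnerProduct.
Variables (R : realType) (n : nat) (g : 'rV[R]_n -> 'rV[R]_n -> R).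
Hypothesis g_lin : forall a x y z, g (a *: x + y) z = a * g x z + g y z.
Hypothesis g_sym : forall x y, g x y = g y x.
Hypothesis g_pos : forall x, x <> 0 -> 0 < g x x.

Let form0l := form0l g_lin.
Let formDl := formDl g_lin.
Let formZl := formZl g_lin.
Let formNl := formNl g_lin.
Let formZr := formZr g_lin g_sym.
Let formNr := formNr g_lin g_sym.
Let form_suml := form_suml g_lin.
Let form_eq0 := form_eq0 g_pos.
Let form_ext := form_ext g_lin g_pos.

Definition gram : 'M[R]_n := \matrix_(i, j) g (delta_mx 0 i) (delta_mx 0 j).

Lemma gramE x y : g x y = (x *m gram *m y^T) 0 0.
Proof.
rewrite {1}(row_sum_delta x) form_suml !mxE.
under [RHS]eq_bigr do rewrite !mxE big_distrl.
rewrite exchange_big /=; apply: eq_bigr => i _.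
rewrite formZl {1}(row_sum_delta y) g_sym form_suml mulr_sumr.
by apply: eq_bigr => j _; rewrite formZl !mxE g_sym; ring.
Qed.

Lemma gram_unit : gram \in unitmx.
Proof.
rewrite -row_free_unit -kermx_eq0; apply/eqP/row_matrixP => i.
rewrite row0; apply: form_eq0.
have /sub_kermxP e : (row i (kermx gram) <= kermx gram)%MS by apply: row_sub.
by rewrite gramE e mul0mx mxE.
Qed.

Lemma form_endo (u : 'M[R]_n) : exists A : 'M[R]_n,
  forall x y, g (x *m A) y = (x *m u *m y^T) 0 0.
Proof.
exists (u *m invmx gram) => x y.
by rewrite gramE !mulmxA mulmxKV // gram_unit.
Qed.

Definition adj (A : 'M[R]_n) := gram *m A^T *m invmx gram.

Lemma adjE A x y : g (x *m adj A) y = g x (y *m A).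
Proof.
rewrite !gramE /adj !mulmxA mulmxKV ?gram_unit //.
by rewrite trmx_mul mulmxA.
Qed.

Lemma adj_tr A : \tr (adj A) = \tr A.
Proof. by rewrite /adj mxtrace_mulC mulmxA mulVmx ?gram_unit // mul1mx mxtrace_tr. Qed.

Lemma adj_unique A B : (forall x y, g (x *m A) y = g x (y *m B)) -> A = adj B.
Proof.
move=> e; apply/row_matrixP => i; rewrite !rowE; apply: form_ext => z.
by rewrite e adjE.
Qed.

Lemma adj_mul A B : adj (A *m B) = adj B *m adj A.
Proof.
apply/esym/adj_unique => x y.
by rewrite (mulmxA x) adjE adjE mulmxA.
Qed.

(** Passing to adjoints preserves the trace and turns A B into - B A. *)
Lemma sym_skew_tr0 A B : (forall x y, g (x *m A) y = g x (y *m A)) ->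
  (forall x y, g (x *m B) y = - g x (y *m B)) -> \tr (A *m B) = 0.
Proof.
move=> /adj_unique sA sB.
have E : - B = adj B.
  by apply: adj_unique => x y; rewrite mulmxN formNl sB opprK.
have := adj_tr (A *m B); rewrite adj_mul -sA -E mxtrace_mulC mulmxN linearN /=.
move=> h; lra.
Qed.

Lemma orthogonal_vector k (e : 'I_k -> 'rV[R]_n) : (k < n)%N ->
  exists2 y, y <> 0 & forall i, g y (e i) = 0.
Proof.
move=> kn.
pose A := \matrix_(a < n, i < k) g (delta_mx 0 a) (e i).
have /rowV0Pn[y /sub_kermxP yA /eqP y0] : kermx A != 0.
  rewrite kermx_eq0 -row_leq_rank -ltnNge.
  exact: leq_ltn_trans (rank_leq_col A) kn.
exists y => // i.
have := congr1 (fun m : 'rV_k => m 0 i) yA; rewrite !mxE => <-.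
rewrite {1}(row_sum_delta y) form_suml.
by apply: eq_bigr => a _; rewrite formZl mxE.
Qed.

Lemma orthonormal_family k : (k <= n)%N -> exists e : 'I_k -> 'rV[R]_n,
  forall i j, g (e i) (e j) = (i == j)%:R.
Proof.
elim: k => [_|k IH kn]; first by exists (fun=> 0); case.
have [e He] := IH (ltnW kn).
have [y /g_pos y0 Hy] := orthogonal_vector e kn.
pose z := (Num.sqrt (g y y))^-1 *: y.
have zz : g z z = 1.
  rewrite formZl formZr mulrA -invfM -expr2 sqr_sqrtr ?ltW // mulVf //.
  by rewrite gt_eqF.
have ze i : g z (e i) = 0 by rewrite formZl Hy mulr0.
exists (fun i => if unlift ord0 i is Some i' then e i' else z) => i j.
case: (unliftP ord0 i) => [i' ->|->]; case: (unliftP ord0 j) => [j' ->|->].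
- by rewrite He (inj_eq lift_inj).
- by rewrite g_sym ze.
- by rewrite ze.
- by rewrite zz eqxx.
Qed.

Section Frame.
Variable e : 'M[R]_n.
Hypothesis e_on : forall i j, g (row i e) (row j e) = (i == j)%:R.

Lemma frame_coord (u : 'rV[R]_n) j : g (u *m e) (row j e) = u 0 j.
Proof.
rewrite mulmx_sum_row form_suml (bigD1 j) //= formZl e_on eqxx mulr1.
by rewrite big1 ?addr0 // => i /negPf ij; rewrite formZl e_on ij mulr0.
Qed.

Lemma frame_unit : e \in unitmx.
Proof.
rewrite -row_free_unit -kermx_eq0; apply/eqP/row_matrixP => i.
have /sub_kermxP k : (row i (kermx e) <= kermx e)%MS by apply: row_sub.
by apply/rowP => j; rewrite -frame_coord k form0l row0 mxE.
Qed.

Lemma frame_expand x : x = \sum_i g x (row i e) *: row i e.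
Proof.
rewrite -{1}(mulmxKV frame_unit x) mulmx_sum_row.
by apply: eq_bigr => i _; rewrite -frame_coord mulmxKV // frame_unit.
Qed.

End Frame.

Lemma orthonormal_frame_exists : exists e : 'M[R]_n,
  forall i j, g (row i e) (row j e) = (i == j)%:R.
Proof.
have [e He] := orthonormal_family (leqnn n).
by exists (\matrix_i e i) => i j; rewrite !rowK.
Qed.

End InnerProduct.

(** * Clifford modules *)

(** The data of one fibre of the spinor bundle. The spinor space is an abstract module without a
    dimension, so that the fibres of a [bundle] are instances; the rank comes in through
    [spinor_span]. *)
Record clifford_module (R : realType) (n : nat) (F : lmodType R)
    (g : 'rV[R]_n -> 'rV[R]_n -> R) (b : F -> F -> R)
    (c : 'rV[R]_n -> F -> F) : Prop := CliffordModule {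
  cm_glin : forall a x y z, g (a *: x + y) z = a * g x z + g y z;
  cm_gsym : forall x y, g x y = g y x;
  cm_gpos : forall x, x <> 0 -> 0 < g x x;
  cm_blin : forall a x y z, b (a *: x + y) z = a * b x z + b y z;
  cm_bsym : forall x y, b x y = b y x;
  cm_bpos : forall x, x <> 0 -> 0 < b x x;
  cm_linl : forall a v w x, c (a *: v + w) x = a *: c v x + c w x;
  cm_linr : forall a v x y, c v (a *: x + y) = a *: c v x + c v y;
  cm_sqr : forall v x, c v (c v x) = - g v v *: x;
  cm_skew : forall v x y, b (c v x) y = - b x (c v y) }.

Lemma linear_row_sum (R : realType) (F : lmodType R) n (f : 'rV[R]_n -> F) :
  (forall a x y, f (a *: x + y) = a *: f x + f y) ->
  forall u, f u = \sum_i u 0 i *: f (delta_mx 0 i).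
Proof.
move=> lf u.
have f0 : f 0 = 0 by have := lf (-1) 0 0; rewrite scaler0 add0r scaleN1r addNr.
have S (l : seq 'I_n) :
    f (\sum_(i <- l) u 0 i *: delta_mx 0 i) = \sum_(i <- l) u 0 i *: f (delta_mx 0 i).
  by elim: l => [|i l IH]; rewrite ?big_nil // !big_cons lf IH.
by rewrite -S -row_sum_delta.
Qed.

Section CliffordModule.
Variables (R : realType) (n : nat) (F : lmodType R).
Variables (g : 'rV[R]_n -> 'rV[R]_n -> R) (b : F -> F -> R) (c : 'rV[R]_n -> F -> F).
Hypothesis H : clifford_module g b c.
Implicit Types (X Y Z : 'rV[R]_n) (x y z : F).

Let glin := cm_glin H.
Let gsym := cm_gsym H.
Let blin := cm_blin H.
Let bsym := cm_bsym H.
Let gE := (formDl glin, formDr glin gsym, formNl glin, formNr glin gsym,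
  formZl glin, formZr glin gsym).
Let bE := (formDl blin, formDr blin bsym, formNl blin, formNr blin bsym,
  formZl blin, formZr blin bsym).
Let bext := form_ext blin (cm_bpos H).

Lemma cliff0l x : c 0 x = 0.
Proof. by have := cm_linl H (-1) 0 0 x; rewrite scaler0 add0r scaleN1r addNr. Qed.
Lemma cliffDl X Y x : c (X + Y) x = c X x + c Y x.
Proof. by have := cm_linl H 1 X Y x; rewrite !scale1r. Qed.
Lemma cliffZl a X x : c (a *: X) x = a *: c X x.
Proof. by have := cm_linl H a X 0 x; rewrite !addr0 cliff0l addr0. Qed.
Lemma cliffNl X x : c (- X) x = - c X x.
Proof. by rewrite -(scaleN1r X) cliffZl scaleN1r. Qed.
Lemma cliff0r X : c X 0 = 0.
Proof. by have := cm_linr H (-1) X 0 0; rewrite scaler0 add0r scaleN1r addNr. Qed.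
Lemma cliffDr X x y : c X (x + y) = c X x + c X y.
Proof. by have := cm_linr H 1 X x y; rewrite !scale1r. Qed.
Lemma cliffZr a X x : c X (a *: x) = a *: c X x.
Proof. by have := cm_linr H a X x 0; rewrite !addr0 cliff0r addr0. Qed.
Lemma cliffNr X x : c X (- x) = - c X x.
Proof. by rewrite -(scaleN1r x) cliffZr scaleN1r. Qed.
Lemma cliff_suml (I : Type) (l : seq I) (X : I -> 'rV[R]_n) x :
  c (\sum_(i <- l) X i) x = \sum_(i <- l) c (X i) x.
Proof.
by elim: l => [|i l IH]; rewrite ?big_nil ?cliff0l // !big_cons cliffDl IH.
Qed.
Lemma cliff_sumr (I : Type) (l : seq I) X (x : I -> F) :
  c X (\sum_(i <- l) x i) = \sum_(i <- l) c X (x i).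
Proof.
by elim: l => [|i l IH]; rewrite ?big_nil ?cliff0r // !big_cons cliffDr IH.
Qed.

Lemma cliff_anti X Y x : c X (c Y x) = - c Y (c X x) - (2 * g X Y) *: x.
Proof.
(* Pairing with an arbitrary z turns an identity of spinors into one of reals, within reach of
   [ring] and [lra]. Here the identity is the polarisation of X X = - g(X, X). *)
apply: bext => z.
have := congr1 (b^~ z) (cm_sqr H (X + Y) x).
rewrite /= !(cliffDl, cliffDr) !(cm_sqr H) !bE !gE (gsym Y X) => h; lra.
Qed.

Lemma cliff_orth X x : b (c X x) x = 0.
Proof. by have := cm_skew H X x x; rewrite (bsym x) => h; lra. Qed.

Lemma cliff_isom X Y x : b (c X x) (c Y x) = g X Y * b x x.
Proof.
have h1 := cm_skew H X x (c Y x); have := cm_skew H Y x (c X x).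
rewrite cliff_anti !bE bsym (gsym Y) => h; lra.
Qed.

Section UnitSpinor.
Variable phi : F.
Hypothesis phi1 : b phi phi = 1.

Lemma cliff_phi X Y : b (c X phi) (c Y phi) = g X Y.
Proof. by rewrite cliff_isom phi1 mulr1. Qed.

Lemma cliff_inj X Y : c X phi = c Y phi -> X = Y.
Proof.
move=> e; apply: (form_ext glin (cm_gpos H)) => Z.
by rewrite -!cliff_phi e.
Qed.

(** A dimension count: (a, X) |-> a phi + X phi preserves norms, hence is injective, from a space of
    dimension n + 1 to one with a basis of n + 1 vectors. P is its matrix in that basis. *)
Lemma spinor_span :
  (exists e : 'I_n.+1 -> F, forall x, exists! a : 'I_n.+1 -> R,
     x = \sum_i a i *: e i) ->
  forall x, exists a X, x = a *: phi + c X phi.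
Proof.
move=> [e He].
have /choice[k Hk] : forall x, exists a : 'I_(1 + n) -> R, x = \sum_i a i *: e i.
  by move=> x; have [a [? _]] := He x; exists a.
pose Phi (u : 'rV[R]_(1 + n)) := lsubmx u 0 0 *: phi + c (rsubmx u) phi.
have lPhi a u w : Phi (a *: u + w) = a *: Phi u + Phi w.
  rewrite /Phi scalerDr scalerA !linearP /= cliffDl cliffZl.
  have -> : (a *: lsubmx u + lsubmx w) 0 0 = a * lsubmx u 0 0 + lsubmx w 0 0.
    by rewrite !mxE.
  by rewrite scalerDl addrACA.
pose P := \matrix_(i, j) k (Phi (delta_mx 0 i)) j.
have PhiE u : Phi u = \sum_j (u *m P) 0 j *: e j.
  rewrite (linear_row_sum lPhi) //.
  under [RHS]eq_bigr do rewrite mxE scaler_suml.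
  rewrite exchange_big; apply: eq_bigr => i _.
  rewrite [in LHS](Hk (Phi _)) scaler_sumr.
  by apply: eq_bigr => j _; rewrite mxE scalerA.
have Pu : P \in unitmx.
  rewrite -row_free_unit -kermx_eq0; apply/eqP/row_matrixP => i.
  have /sub_kermxP K : (row i (kermx P) <= kermx P)%MS by apply: row_sub.
  set u := row _ _ in K *.
  have Z : Phi u = 0 by rewrite PhiE K big1 // => j _; rewrite mxE scale0r.
  have : b (Phi u) (Phi u) = 0 by rewrite Z (form0l blin).
  rewrite {1 2}/Phi !bE phi1 cliff_phi cliff_orth (bsym phi) cliff_orth.
  set q := g _ _; set s := lsubmx u 0 0 => hq.
  have q0 : 0 <= q.
    have [/(congr1 (fun X => g X X))|/(cm_gpos H)/ltW //] := pselect (rsubmx u = 0).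
    by rewrite (form0l glin) /q => ->.
  have s0 : s = 0 by apply/eqP; rewrite -sqrf_eq0; apply/eqP; nra.
  have /(form_eq0 (cm_gpos H)) r0 : q = 0 by move: hq; rewrite s0; lra.
  rewrite row0 -[u]hsubmxK r0 (_ : lsubmx u = 0) ?row_mx0 //.
  by apply/matrixP => a d; rewrite !ord1 [RHS]mxE -s0.
move=> x; pose u := (\row_j k x j) *m invmx P.
exists (lsubmx u 0 0), (rsubmx u).
rewrite -/(Phi u) PhiE mulmxKV // [LHS](Hk x).
by apply: eq_bigr => j _; rewrite mxE.
Qed.

Hypothesis span : forall x, exists a X, x = a *: phi + c X phi.

Lemma spinor_perp x : b x phi = 0 -> exists X, x = c X phi.
Proof.
have [a [X ->]] := span x; rewrite !bE phi1 cliff_orth addr0 mulr1 => ->.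
by exists X; rewrite scale0r add0r.
Qed.

Lemma spinor_ext x y : b x phi = b y phi ->
  (forall X, b x (c X phi) = b y (c X phi)) -> x = y.
Proof.
move=> e E; apply: bext => z; have [a [X ->]] := span z.
by rewrite !bE e E.
Qed.

(* If l phi = Z phi, then for orthogonal X, Y, Z with C phi = X Y phi
   orthogonal to Z phi, both l (C phi) = C Z phi and
   l (X Y phi) = X Y Z phi = Z C phi = - C Z phi. *)
Lemma commuting_skew_spinor0 (l : F -> F) : (3 < n)%N ->
  (forall X x, l (c X x) = c X (l x)) ->
  (forall x y, b (l x) y = - b x (l y)) -> l phi = 0.
Proof.
move=> n3 lc ls.
have lp : b (l phi) phi = 0 by have := ls phi phi; rewrite (bsym phi) => h; lra.
have [Z EZ] := spinor_perp lp.
have [X X0 XZ] := orthogonal_vector glin (fun _ : 'I_1 => Z) (ltnW (ltnW n3)).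
have {}XZ : g X Z = 0 := XZ ord0.
(* C' serves to choose Y: (C phi, Z phi) = - (Y phi, X Z phi) = - g(Y, C'). The bound n > 3 leaves
   room for the three conditions on Y. *)
have [C' EC'] : exists C', c X (c Z phi) = c C' phi.
  by apply: spinor_perp; rewrite (cm_skew H) cliff_phi gsym XZ oppr0.
have [Y Y0 YY] := orthogonal_vector glin
  (fun i : 'I_3 => nth 0 [:: X; Z; C'] i) n3.
have YX : g Y X = 0 := YY ord0.
have YZ : g Y Z = 0 := YY (lift ord0 ord0).
have YC' : g Y C' = 0 := YY ord_max.
have [C EC] : exists C, c X (c Y phi) = c C phi.
  by apply: spinor_perp; rewrite (cm_skew H) cliff_phi YX oppr0.
have CZ : g C Z = 0.
  by rewrite -cliff_phi -EC (cm_skew H) EC' cliff_phi YC' oppr0.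
have anti0 U V x : g U V = 0 -> c U (c V x) = - c V (c U x).
  by move=> e; rewrite cliff_anti e mulr0 scale0r subr0.
have h1 : l (c C phi) = - c Z (c C phi) by rewrite lc EZ anti0.
have h2 : l (c C phi) = c Z (c C phi).
  rewrite -EC !lc EZ (anti0 Y Z) // cliffNr (anti0 X Z) //.
  by rewrite opprK.
have h3 : c Z (c C phi) = 0.
  apply: bext => z; have := congr1 (b^~ z) (etrans (esym h1) h2).
  by rewrite /= !bE (form0l blin) => h; lra.
have h4 : b (c Z (c C phi)) (c Z (c C phi)) = g Z Z * (g X X * g Y Y).
  by rewrite cliff_isom -EC cliff_isom cliff_phi.
have X1 := cm_gpos H X0; have Y1 := cm_gpos H Y0.
have : g Z Z = 0.
  apply/eqP; have /eqP := h4; rewrite h3 (form0l blin) eq_sym !mulf_eq0.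
  by rewrite (gt_eqF X1) (gt_eqF Y1) !orbF.
by move/(form_eq0 (cm_gpos H)) => Z0; rewrite EZ Z0 cliff0l.
Qed.

End UnitSpinor.
End CliffordModule.

(** * Bivectors and the 3-form *)

Section Bivector.
Variables (R : realType) (n : nat) (F : lmodType R).
Variables (g : 'rV[R]_n -> 'rV[R]_n -> R) (b : F -> F -> R) (c : 'rV[R]_n -> F -> F).
Hypothesis H : clifford_module g b c.
Implicit Types (X Y Z : 'rV[R]_n) (x y z : F).

Let glin := cm_glin H.
Let gsym := cm_gsym H.
Let blin := cm_blin H.
Let bsym := cm_bsym H.
Let gE := (formDl glin, formDr glin gsym, formNl glin, formNr glin gsym,
  formZl glin, formZr glin gsym).
Let bE := (formDl blin, formDr blin bsym, formNl blin, formNr blin bsym,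
  formZl blin, formZr blin bsym).
Let cE := (cliffDl H, cliffDr H, cliffNl H, cliffNr H, cliffZl H, cliffZr H).
Let bext := form_ext blin (cm_bpos H).

Definition skew_form (A : 'M[R]_n) := forall X Y, g (X *m A) Y = - g X (Y *m A).
Definition sym_form (A : 'M[R]_n) := forall X Y, g (X *m A) Y = g X (Y *m A).

Variable e : 'M[R]_n.
Hypothesis e_on : forall i j, g (row i e) (row j e) = (i == j)%:R.

Let expand X : X = \sum_i g X (row i e) *: row i e := frame_expand glin e_on X.

Lemma trace_frame A : \tr A = \sum_i g (row i e *m A) (row i e).
Proof.
pose T := \matrix_(i, j) g (row i e *m A) (row j e).
have eu := frame_unit glin e_on.
have ET : e *m A = T *m e.
  apply/row_matrixP => i; rewrite !row_mul (mulmx_sum_row (row i T)) [LHS]expand.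
  by apply: eq_bigr => j _; rewrite !mxE.
have {1}-> : A = invmx e *m (T *m e) by rewrite -ET mulKmx.
rewrite mxtrace_mulC mulmxK //.
by apply: eq_bigr => i _; rewrite mxE.
Qed.

(* The action on spinors of the skew endomorphism A, viewed as an element of
   the Lie algebra spin(n). *)
Definition bivector (A : 'M[R]_n) x :=
  4^-1 *: \sum_i c (row i e) (c (row i e *m A) x).

(** Moving X to the left past e_i (A e_i) leaves two terms, each of which sums over the frame to 2
    A(X); the factor 1/4 in [bivector] compensates for both. *)
Lemma bivector_comm A X x : skew_form A ->
  bivector A (c X x) = c (X *m A) x + c X (bivector A x).
Proof.
move=> sA; rewrite /bivector.
have E i : c (row i e) (c (row i e *m A) (c X x)) =
    c X (c (row i e) (c (row i e *m A) x)) +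
    ((2 * g X (row i e)) *: c (row i e *m A) x +
     (2 * g (X *m A) (row i e)) *: c (row i e) x).
  apply: bext => z.
  have h1 := cliff_anti H (row i e *m A) X x.
  have h2 := cliff_anti H (row i e) X (c (row i e *m A) x).
  rewrite h1 !cE h2 !bE sA (gsym (row i e)) (gsym (row i e) (X *m A)).
  ring.
rewrite (eq_bigr _ (fun i _ => E i)) !big_split /=.
have -> : \sum_i (2 * g X (row i e)) *: c (row i e *m A) x = 2 *: c (X *m A) x.
  rewrite {2}(expand X) mulmx_suml (cliff_suml H) scaler_sumr.
  by apply: eq_bigr => i _; rewrite -scalemxAl (cliffZl H) scalerA.
have -> : \sum_i (2 * g (X *m A) (row i e)) *: c (row i e) x = 2 *: c (X *m A) x.
  rewrite {2}(expand (X *m A)) (cliff_suml H) scaler_sumr.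
  by apply: eq_bigr => i _; rewrite (cliffZl H) scalerA.
rewrite (cliffZr H) (cliff_sumr H); apply: bext => z; rewrite !bE; lra.
Qed.

Lemma bivector_skew A x y : skew_form A ->
  b (bivector A x) y = - b x (bivector A y).
Proof.
move=> sA; rewrite /bivector !bE (form_suml blin) (bsym x) (form_suml blin).
rewrite -mulrN -sumrN; congr (_ * _); apply: eq_bigr => i _.
have g0 : g (row i e) (row i e *m A) = 0.
  by have := sA (row i e) (row i e); rewrite gsym => h; lra.
rewrite (cm_skew H) (cm_skew H (row i e *m A)) opprK.
rewrite (bsym (c (row i e) _) x) (cliff_anti H (row i e)).
by rewrite g0 mulr0 scale0r subr0 !bE opprK.
Qed.

Variable phi : F.
Hypothesis phi1 : b phi phi = 1.
Hypothesis span : forall x, exists a X, x = a *: phi + c X phi.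

Definition threeform X Y Z := b (c X (c Y (c Z phi))) phi.

(** The bivector is skew on spinors and kills phi, so it sends X Y Z phi to a spinor orthogonal to
    phi; commuting it through the three factors gives the infinitesimal invariance of the 3-form. *)
Lemma bivector_stabiliser A X Y Z : skew_form A -> bivector A phi = 0 ->
  threeform (X *m A) Y Z + threeform X (Y *m A) Z + threeform X Y (Z *m A) = 0.
Proof.
move=> sA A0; have := bivector_skew (c X (c Y (c Z phi))) phi sA.
rewrite A0 (form0r blin bsym).
rewrite !bivector_comm // A0 (cliff0r H) addr0 !cE !bE /threeform.
by move=> h; lra.
Qed.

Lemma threeform_endo Z : exists A : 'M[R]_n,
  forall X Y, g (X *m A) Y = threeform Z X Y.
Proof.
have [A HA] := form_endo glin gsym (cm_gpos H)
  (\matrix_(i, j) threeform Z (delta_mx 0 i) (delta_mx 0 j)).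
exists A => X Y; rewrite HA !mxE.
have l1 U a u w : threeform Z (a *: u + w) U = a *: (threeform Z u U : R^o) + threeform Z w U.
  by rewrite /threeform !cE !bE.
have l2 U a u w : threeform Z U (a *: u + w) = a *: (threeform Z U u : R^o) + threeform Z U w.
  by rewrite /threeform !cE !bE.
rewrite (linear_row_sum (F := R^o) (l2 X)).
apply: eq_bigr => j _; rewrite !mxE mulrC; congr (_ * _).
rewrite (linear_row_sum (F := R^o) (l1 _)).
by apply: eq_bigr => i _; rewrite !mxE.
Qed.

Section Contraction.
Variables (Z : 'rV[R]_n) (A : 'M[R]_n).
Hypothesis HA : forall X Y, g (X *m A) Y = threeform Z X Y.

Lemma contraction_skew : skew_form A.
Proof.
move=> X Y; rewrite HA gsym HA /threeform (cliff_anti H X Y) !cE !bE.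
by rewrite (cliff_orth H) mulr0 subr0.
Qed.

(** Both sides are tested against phi and every Y phi. In dimension 7, A is up to sign the cross
    product with Z. *)
Lemma contraction_cliff X : c (X *m A) phi = - c Z (c X phi) - g X Z *: phi.
Proof.
apply: (spinor_ext H span) => [|Y].
  rewrite (cliff_orth H) !bE (cm_skew H) (cliff_phi H phi1) phi1 gsym; ring.
rewrite (cliff_phi H phi1) HA /threeform !bE (bsym phi) (cliff_orth H).
rewrite (cm_skew H) (cm_skew H) (cliff_anti H X Z) !bE (bsym _ phi) (bsym phi).
rewrite (cliff_orth H) (bsym (c Y phi)); ring.
Qed.

(** Each e_i contributes g(Z, e_i) e_i phi - Z phi; the first terms add up to Z phi, the second to -
    n Z phi. In dimension 7 the constant is - 3/2. *)
Lemma contraction_bivector : bivector A phi = - ((n%:R - 1) / 4) *: c Z phi.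
Proof.
rewrite /bivector.
have E i : c (row i e) (c (row i e *m A) phi) =
    g Z (row i e) *: c (row i e) phi - c Z phi.
  rewrite contraction_cliff !cE (cliff_anti H (row i e) Z) (cm_sqr H) e_on eqxx.
  by rewrite mulr1n (gsym _ Z) !cE; apply: bext => z; rewrite !bE; ring.
rewrite (eq_bigr _ (fun i _ => E i)) big_split /=.
have -> : \sum_i g Z (row i e) *: c (row i e) phi = c Z phi.
  rewrite {2}(expand Z) (cliff_suml H).
  by apply: eq_bigr => i _; rewrite (cliffZl H).
by rewrite sumr_const card_ord -[_ *+ n]scaler_nat; apply: bext => z; rewrite !bE; ring.
Qed.

End Contraction.

(* so(n) = g_2 + R^n for n = 7; B is in g_2 because its bivector kills phi. *)
Lemma skew_decomposition A : (1 < n)%N -> skew_form A ->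
  exists (B C : 'M[R]_n) Z, [/\ skew_form B, bivector B phi = 0,
    forall X Y, g (X *m C) Y = threeform Z X Y & A = B + C].
Proof.
move=> n1 sA.
have ap : b (bivector A phi) phi = 0.
  by have := bivector_skew phi phi sA; rewrite (bsym phi) => h; lra.
have [Y EY] := spinor_perp H phi1 span ap.
pose k : R := (n%:R - 1) / 4.
have k0 : k != 0.
  by rewrite mulf_neq0 // subr_eq0 gt_eqF // ltr1n.
(* The vector is scaled so that C acts on phi as A does: [contraction_bivector] sends phi to - k (-
   k^-1 Y) phi = Y phi. *)
have [C HC] := threeform_endo (- k^-1 *: Y).
have sC := contraction_skew HC.
exists (A - C), C, (- k^-1 *: Y); split=> //; last by rewrite subrK.
  by move=> X X'; rewrite !mulmxBr !gE sA sC; ring.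
have -> : bivector (A - C) phi = bivector A phi - bivector C phi.
  rewrite /bivector -scalerBr -sumrB; congr (_ *: _); apply: eq_bigr => i _.
  by rewrite mulmxBr !cE.
rewrite EY (contraction_bivector HC) -/k !cE scalerA mulrN mulNr opprK.
by rewrite mulfV // scale1r subrr.
Qed.

End Bivector.

(** * The G_2 modules *)

Section Classes.
Variables (R : realType) (F : lmodType R).
Variables (g : 'rV[R]_7 -> 'rV[R]_7 -> R) (b : F -> F -> R) (c : 'rV[R]_7 -> F -> F).
Hypothesis H : clifford_module g b c.
Variable phi : F.
Hypothesis phi1 : b phi phi = 1.
Hypothesis span : forall x, exists a X, x = a *: phi + c X phi.
Implicit Types (X Y Z : 'rV[R]_7) (A : 'M[R]_7).

Let glin := cm_glin H.
Let gsym := cm_gsym H.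
Let blin := cm_blin H.
Let bsym := cm_bsym H.
Let gE := (formDl glin, formDr glin gsym, formNl glin, formNr glin gsym,
  formZl glin, formZr glin gsym).
Let bE := (formDl blin, formDr blin bsym, formNl blin, formNr blin bsym,
  formZl blin, formZr blin bsym).
Let cE := (cliffDl H, cliffDr H, cliffNl H, cliffNr H, cliffZl H, cliffZr H).

(** [G2_module] in one fibre, for an abstract Clifford module. It is kept convertible with the
    original, as is [g2_class] with [G2_class], so that the fibrewise result closes the final goal
    by conversion. *)
Definition g2_module (i : nat) A : Prop :=
  match i with
  | 1 => exists a : R, A = a%:M
  | 2 => skew_form g A /\ forall X Y Z,
      threeform b c phi (X *m A) Y Z + threeform b c phi X (Y *m A) Z +
      threeform b c phi X Y (Z *m A) = 0
  | 3 => sym_form g A /\ \tr A = 0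
  | 4 => exists Z, forall X Y, g (X *m A) Y = threeform b c phi Z X Y
  | _ => False
  end.

Definition g2_class (alpha : seq nat) A : Prop :=
  exists2 B : nat -> 'M[R]_7,
    forall i, i \in alpha -> g2_module i (B i) & A = \sum_(i <- alpha) B i.

Lemma g2_moduleD i A B : g2_module i A -> g2_module i B -> g2_module i (A + B).
Proof.
case: i => [|[|[|[|[|i]]]]] //=.
- by move=> [x ->] [y ->]; exists (x + y); rewrite raddfD.
- move=> [sA hA] [sB hB]; split=> X Y; first by rewrite !mulmxDr !gE sA sB; ring.
  move=> Z; have := hA X Y Z; have := hB X Y Z.
  by rewrite /threeform !mulmxDr !cE !bE => h1 h2; lra.
- move=> [sA tA] [sB tB]; split; first by move=> X Y; rewrite !mulmxDr !gE sA sB.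
  by rewrite raddfD /= tA tB addr0.
- move=> [Z hA] [Z' hB]; exists (Z + Z') => X Y.
  by rewrite mulmxDr gE hA hB /threeform !cE !bE.
Qed.

Lemma g2_moduleZ i k A : g2_module i A -> g2_module i (k *: A).
Proof.
case: i => [|[|[|[|[|i]]]]] //=.
- by move=> [x ->]; exists (k * x); rewrite scale_scalar_mx.
- move=> [sA hA]; split=> X Y; first by rewrite -!scalemxAr !gE sA; ring.
  move=> Z; have := hA X Y Z.
  rewrite /threeform -!scalemxAr !cE !bE => h1.
  by rewrite -!mulrDr h1 mulr0.
- move=> [sA tA]; split; first by move=> X Y; rewrite -!scalemxAr !gE sA.
  by rewrite linearZ /= tA mulr0.
- move=> [Z hA]; exists (k *: Z) => X Y.
  by rewrite -scalemxAr gE hA /threeform !cE !bE.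
Qed.

Lemma g2_module0 i : i \in [:: 1; 2; 3; 4]%N -> g2_module i 0.
Proof.
rewrite !inE => /or4P[] /eqP ->.
- by exists 0; rewrite raddf0.
- split=> X Y; first by rewrite !mulmx0 (form0l glin) (form0r glin gsym) oppr0.
  move=> Z; rewrite /threeform !mulmx0 !(cliff0l H) !(cliff0r H).
  by rewrite (form0l blin) !addr0.
- split; last by rewrite raddf0.
  by move=> X Y; rewrite !mulmx0 (form0l glin) (form0r glin gsym).
- exists 0 => X Y.
  by rewrite /threeform mulmx0 (cliff0l H) (form0l blin) (form0l glin).
Qed.

Lemma g2_classD alpha A B :
  g2_class alpha A -> g2_class alpha B -> g2_class alpha (A + B).
Proof.
move=> [P hP ->] [Q hQ ->]; exists (fun i => P i + Q i); last by rewrite big_split.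
by move=> i ia; apply: g2_moduleD; [apply: hP|apply: hQ].
Qed.

Lemma g2_classZ alpha k A : g2_class alpha A -> g2_class alpha (k *: A).
Proof.
move=> [P hP ->]; exists (fun i => k *: P i); last by rewrite scaler_sumr.
by move=> i ia; apply/g2_moduleZ/hP.
Qed.

(** The other components are filled with 0, which requires the indices to lie in 1, ..., 4, since
    [g2_module] is empty at all others; [uniq] keeps A from being counted twice. *)
Lemma g2_module_class alpha i A : uniq alpha -> i \in alpha ->
  all (fun k => k \in [:: 1; 2; 3; 4]%N) alpha ->
  g2_module i A -> g2_class alpha A.
Proof.
move=> ua ia aa hA.
exists (fun k => if k == i then A else 0).
  by move=> k ka; case: eqP => [->|_] //; apply/g2_module0/(allP aa).
rewrite (bigD1_seq i) //= eqxx big1 ?addr0 // => k /negPf ->; by [].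
Qed.

Lemma g2_class_sub alpha beta A : uniq beta ->
  all (fun k => k \in [:: 1; 2; 3; 4]%N) beta -> {subset alpha <= beta} ->
  g2_class alpha A -> g2_class beta A.
Proof.
move=> ub ab sab [B hB ->].
rewrite big_seq; apply: big_ind; last first.
- by move=> i ia; apply: (g2_module_class ub (sab i ia) ab); apply: hB.
- exact: g2_classD.
- exists (fun=> 0); last by rewrite big1.
  by move=> i /(allP ab)/g2_module0.
Qed.

Variable e : 'M[R]_7.
Hypothesis e_on : forall i j, g (row i e) (row j e) = (i == j)%:R.

Lemma bivector0_g2 A : skew_form g A -> bivector c e A phi = 0 -> g2_module 2 A.
Proof.
by move=> sA A0; split=> // X Y Z; apply: (bivector_stabiliser H e_on).
Qed.

Lemma skew_class alpha A : uniq alpha -> 2%N \in alpha -> 4%N \in alpha ->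
  all (fun k => k \in [:: 1; 2; 3; 4]%N) alpha -> skew_form g A -> g2_class alpha A.
Proof.
move=> ua a2 a4 aa sA.
have [//|B [C [Z [sB B0 hC ->]]]] := skew_decomposition H e_on phi1 span _ sA.
apply: g2_classD; first exact: (g2_module_class ua a2 aa (bivector0_g2 sB B0)).
by apply: (g2_module_class ua a4 aa); exists Z.
Qed.

Lemma traceless_class A : \tr A = 0 -> g2_class [:: 2; 3; 4]%N A.
Proof.
move=> tA; pose A' := adj g A.
have HA' X Y : g (X *m A') Y = g X (Y *m A) := adjE glin gsym (cm_gpos H) A X Y.
(* Skew and symmetric parts: the skew part falls in W_2 + W_4, and the symmetric part inherits the
   vanishing trace of A, since the adjoint has the same trace. *)
have -> : A = 2^-1 *: (A - A') + 2^-1 *: (A + A').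
  by rewrite -scalerDr addrACA addNr addr0 -mulr2n -[A *+ 2]scaler_nat scalerA mulVf ?scale1r.
apply: g2_classD; apply: g2_classZ.
  apply: skew_class => // X Y; rewrite !mulmxBr !gE HA' (gsym X (Y *m A')) HA'.
  by rewrite (gsym Y); ring.
apply: (@g2_module_class _ 3) => //; split.
  move=> X Y; rewrite !mulmxDr !gE HA' (gsym X (Y *m A')) HA' (gsym Y).
  ring.
by rewrite linearD /= (adj_tr glin gsym (cm_gpos H)) tA addr0.
Qed.

End Classes.

(** * Hypersurfaces: linear algebra *)

Section RowProduct.
Variables (R : realType) (F : lmodType R) (n : nat) (c : 'rV[R]_n -> F -> F).

(* [frame_product] for rectangular matrices *)
Definition row_product m (A : 'M[R]_(m, n)) (z : F) : F :=
  foldr (fun i y => c (row i A) y) z (enum 'I_m).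

Lemma row_product_col m1 m2 (A : 'M[R]_(m1, n)) (B : 'M[R]_(m2, n)) z :
  row_product (col_mx A B) z = row_product A (row_product B z).
Proof.
rewrite /row_product.
have -> : enum 'I_(m1 + m2) = map (lshift m2) (enum 'I_m1) ++ map (@rshift m1 m2) (enum 'I_m2).
  apply: (inj_map val_inj); rewrite map_cat [LHS]val_enum_ord iotaD.
  rewrite -(map_comp _ (lshift m2)) -(map_comp _ (@rshift m1 m2)).
  congr (_ ++ _); first by rewrite -val_enum_ord; apply: eq_map.
  have -> : iota (0 + m1) m2 = map (addn m1) (iota 0 m2) by rewrite -iotaDl addn0.
  by rewrite -val_enum_ord -(map_comp _ val); apply: eq_map.
rewrite foldr_cat !foldr_map.
have -> : (fun i y => c (row (lshift m2 i) (col_mx A B)) y) = fun i y => c (row i A) y.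
  by apply/funext => i; rewrite rowKu.
have -> // : (fun i y => c (row (rshift m1 i) (col_mx A B)) y) = fun i y => c (row i B) y.
by apply/funext => i; rewrite rowKd.
Qed.

End RowProduct.

Section Hypersurface.
Variables (R : realType) (F : lmodType R).
Variables (g : 'rV[R]_7 -> 'rV[R]_7 -> R) (b : F -> F -> R) (c : 'rV[R]_7 -> F -> F).
Hypothesis H : clifford_module g b c.
Variable phi : F.
Hypothesis phi1 : b phi phi = 1.
Hypothesis span : forall x, exists a X, x = a *: phi + c X phi.
Variables (d : 'M[R]_(6, 7)) (V : 'rV[R]_7).
Hypothesis V1 : g V V = 1.
Hypothesis dV : forall x : 'rV[R]_6, g (x *m d) V = 0.
Hypothesis d_inj : forall x : 'rV[R]_6, x *m d = 0 -> x = 0.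
Variable J : 'M[R]_6.
Hypothesis HJ : forall x : 'rV[R]_6, c (x *m J *m d) phi = c V (c (x *m d) phi).
Implicit Types (X Y Z : 'rV[R]_7) (A : 'M[R]_7) (x y : 'rV[R]_6) (B S W : 'M[R]_6).

Let glin := cm_glin H.
Let gsym := cm_gsym H.
Let blin := cm_blin H.
Let bsym := cm_bsym H.
Let gE := (formDl glin, formDr glin gsym, formNl glin, formNr glin gsym,
  formZl glin, formZr glin gsym).
Let bE := (formDl blin, formDr blin bsym, formNl blin, formNr blin bsym,
  formZl blin, formZr blin bsym).
Let cE := (cliffDl H, cliffDr H, cliffNl H, cliffNr H, cliffZl H, cliffZr H).
Let bext := form_ext blin (cm_bpos H).

Definition induced_form x y := g (x *m d) (y *m d).
Local Notation g6 := induced_form.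

Lemma induced_lin a x y z : g6 (a *: x + y) z = a * g6 x z + g6 y z.
Proof. by rewrite /g6 mulmxDl -scalemxAl !gE. Qed.
Lemma induced_sym x y : g6 x y = g6 y x. Proof. exact: gsym. Qed.
Lemma induced_pos x : x <> 0 -> 0 < g6 x x.
Proof. by move=> x0; apply: (cm_gpos H) => /d_inj. Qed.

Let Vd x : g V (x *m d) = 0. Proof. by rewrite gsym dV. Qed.

(** The size 6 + 1 computes to 7, so block operations apply while the matrix still acts on the
    7-dimensional space. *)
Definition adapted : 'M[R]_(6 + 1) := col_mx d V.
Local Notation E := adapted.

Lemma adapted_unit : E \in unitmx.
Proof.
rewrite -row_free_unit -kermx_eq0; apply/eqP/row_matrixP => i.
have /sub_kermxP : (row i (kermx E) <= kermx E)%MS by apply: row_sub.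
rewrite row0; set u := row _ _; rewrite -[u]hsubmxK mul_row_col => K.
have KV : g (lsubmx u *m d + rsubmx u *m V) V = 0 by rewrite K (form0l glin).
have r0 : rsubmx u = 0.
  apply/rowP => k; rewrite ord1 [RHS]mxE.
  by rewrite [rsubmx u]mx11_scalar mul_scalar_mx !gE dV V1 add0r mulr1 in KV.
by rewrite r0 (d_inj (x := lsubmx u)) ?row_mx0 //; move: K; rewrite r0 mul0mx addr0.
Qed.

Lemma adapted_decomp X : exists x a, X = x *m d + a *: V.
Proof.
pose u : 'rV[R]_(6 + 1) := X *m invmx E.
exists (lsubmx u), (rsubmx u 0 0).
by rewrite -mul_scalar_mx -mx11_scalar -mul_row_col hsubmxK mulmxKV // adapted_unit.
Qed.

(* The endomorphism x |-> B x + w(x) V on TM, sending V to 0. *)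
Definition extend B (w : 'cV[R]_6) : 'M[R]_7 :=
  invmx E *m block_mx B w 0 0 *m E.

Lemma extend_tangent B w x :
  x *m d *m extend B w = x *m B *m d + (x *m w) 0 0 *: V.
Proof.
have -> : x *m d = row_mx x 0 *m E by rewrite mul_row_col mul0mx addr0.
rewrite /extend !mulmxA mulmxK ?adapted_unit //.
rewrite mul_row_block !mul0mx !addr0 mul_row_col.
by rewrite -mul_scalar_mx -mx11_scalar.
Qed.

Lemma extend_normal B w : V *m extend B w = 0.
Proof.
have -> : V = row_mx 0 1%:M *m E by rewrite mul_row_col mul0mx mul1mx add0r.
rewrite /extend !mulmxA mulmxK ?adapted_unit //.
by rewrite mul_row_block !mul0mx !mulmx0 !addr0 row_mx0 mul0mx.
Qed.

Lemma extend_trace B w : \tr (extend B w) = \tr B.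
Proof.
rewrite /extend mxtrace_mulC mulmxA mulmxV ?adapted_unit // mul1mx.
by rewrite mxtrace_block raddf0 addr0.
Qed.

Lemma extend_unique A B w : V *m A = 0 ->
  (forall x, x *m d *m A = x *m B *m d + (x *m w) 0 0 *: V) -> A = extend B w.
Proof.
move=> VA dA; apply/row_matrixP => i; rewrite !rowE.
have [x [a ->]] := adapted_decomp (delta_mx 0 i).
by rewrite !mulmxDl -!scalemxAl VA extend_normal dA extend_tangent.
Qed.

Lemma extendD B B' w w' : extend (B + B') (w + w') = extend B w + extend B' w'.
Proof.
apply/esym/extend_unique; first by rewrite mulmxDr !extend_normal addr0.
move=> x; rewrite mulmxDr !extend_tangent !mulmxDr mulmxDl.
have -> : (x *m w + x *m w') 0 0 = (x *m w) 0 0 + (x *m w') 0 0 by rewrite mxE.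
by rewrite scalerDl addrACA.
Qed.

Lemma extendZ k B w : extend (k *: B) (k *: w) = k *: extend B w.
Proof.
apply/esym/extend_unique; first by rewrite -scalemxAr extend_normal scaler0.
move=> x; rewrite -!scalemxAr extend_tangent -scalemxAl scalerDr scalerA.
by have -> : (k *: (x *m w)) 0 0 = k * (x *m w) 0 0 by rewrite mxE.
Qed.

Lemma extendM B B' : extend B 0 *m extend B' 0 = extend (B *m B') 0.
Proof.
apply: extend_unique; first by rewrite mulmxA extend_normal mul0mx.
move=> x; rewrite mulmxA extend_tangent !mulmx0 !mxE !scale0r !addr0.
by rewrite extend_tangent !mulmx0 !mxE scale0r addr0 mulmxA.
Qed.

Lemma extend_tangent0 B x : x *m d *m extend B 0 = x *m B *m d.
Proof. by rewrite extend_tangent mulmx0 mxE scale0r addr0. Qed.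

Lemma extend_skew B : skew_form g6 B -> skew_form g (extend B 0).
Proof.
move=> sB X Y.
have [x [s ->]] := adapted_decomp X; have [y [t ->]] := adapted_decomp Y.
rewrite !mulmxDl -!scalemxAl !extend_normal !scaler0 !addr0 !extend_tangent0.
by rewrite !gE dV Vd; have := sB x y; rewrite /g6 => ->; ring.
Qed.

Lemma extend_sym B : sym_form g6 B -> sym_form g (extend B 0).
Proof.
move=> sB X Y.
have [x [s ->]] := adapted_decomp X; have [y [t ->]] := adapted_decomp Y.
rewrite !mulmxDl -!scalemxAl !extend_normal !scaler0 !addr0 !extend_tangent0.
by rewrite !gE dV Vd; have := sB x y; rewrite /g6 => ->; ring.
Qed.

(** Under the injection X |-> X phi, J becomes Clifford multiplication by V, which squares to - g(V,
    V) = - 1 and is skew; hence this lemma and the next. *)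
Lemma complex_sqr : J *m J = - 1%:M.
Proof.
apply/row_matrixP => i; rewrite !rowE; set x := delta_mx 0 i.
apply/eqP; rewrite -subr_eq0; apply/eqP/d_inj.
rewrite mulmxBl mulmxN mulmx1 mulNmx opprK; apply: (cliff_inj H phi1).
by rewrite (cliff0l H) (cliffDl H) mulmxA !HJ (cm_sqr H) V1 scaleN1r addNr.
Qed.

Lemma complex_skew : skew_form g6 J.
Proof.
move=> x y; rewrite /g6 -!(cliff_phi H phi1) !HJ.
exact: (cm_skew H).
Qed.

Section Types.
Variable S : 'M[R]_6.

Lemma sym_commuting_skew : sym_form g6 S -> J *m S = S *m J ->
  skew_form g6 (S *m J).
Proof.
move=> sS JS x y; rewrite mulmxA complex_skew sS.
by rewrite -(mulmxA y) JS.
Qed.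

Lemma skew_commuting_sym : skew_form g6 S -> J *m S = S *m J ->
  sym_form g6 (S *m J).
Proof.
move=> sS JS x y; rewrite mulmxA complex_skew sS opprK.
by rewrite -(mulmxA y) JS.
Qed.

Lemma sym_anticommuting_sym : sym_form g6 S -> J *m S = - (S *m J) ->
  sym_form g6 (S *m J).
Proof.
move=> sS JS x y; rewrite mulmxA complex_skew sS -(mulmxA y) JS mulmxN.
by rewrite /g6 mulNmx (formNr glin gsym) opprK.
Qed.

Lemma skew_anticommuting_skew : skew_form g6 S -> J *m S = - (S *m J) ->
  skew_form g6 (S *m J).
Proof.
move=> sS JS x y; rewrite mulmxA complex_skew sS opprK -(mulmxA y) JS mulmxN.
by rewrite /g6 mulNmx (formNr glin gsym).
Qed.

End Types.

Lemma extend_sym_module B : sym_form g6 B -> \tr B = 0 ->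
  g2_module g b c phi 3 (extend B 0).
Proof.
by move=> sB tB; split; [apply: extend_sym|rewrite extend_trace].
Qed.

Lemma extend_id_class alpha : uniq alpha -> 1%N \in alpha -> 3%N \in alpha ->
  all (fun k => k \in [:: 1; 2; 3; 4]%N) alpha ->
  g2_class g b c phi alpha (extend 1%:M 0).
Proof.
move=> ua a1 a3 aa.
(* The identity of TM, extended by 0 on V, has trace 6, so it becomes traceless in dimension 7 after
   subtracting 6/7 Id. *)
rewrite -[extend _ _](subrK ((6 / 7) : R)%:M) addrC.
apply: (g2_classD H).
  by apply: (g2_module_class H ua a1 aa); exists (6 / 7).
apply: (g2_module_class H ua a3 aa); split.
  have sI : sym_form g (extend 1%:M 0).
    by apply: extend_sym => x y; rewrite !mulmx1.
  by move=> X Y; rewrite !mulmxBr !gE sI !mul_mx_scalar !gE.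
by rewrite raddfB /= extend_trace !mxtrace_scalar; lra.
Qed.

(** [contraction_cliff] at Z = - V reads A(X) phi = V X phi + g(X, V) phi, which is (J X) phi for
    tangent X and 0 for X = V. *)
Lemma extend_complex_module : g2_module g b c phi 4 (extend J 0).
Proof.
exists (- V) => X Y.
have [A HA] := threeform_endo H phi (- V).
rewrite -HA; congr (g _ Y).
apply: (cliff_inj H phi1).
rewrite (contraction_cliff H phi1 span HA) (cliffNl H) opprK.
have [x [a ->]] := adapted_decomp X.
rewrite !mulmxDl -!scalemxAl extend_normal scaler0 addr0 extend_tangent0 HJ.
rewrite !cE !gE dV V1 (cm_sqr H) V1; apply: bext => z; rewrite !bE; ring.
Qed.

Lemma normal_tangent_pair x y z :
  c V (c (x *m d) (c V (c (y *m d) z))) = c (x *m d) (c (y *m d) z).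
Proof.
by rewrite (cliff_anti H (x *m d)) dV mulr0 scale0r subr0 (cliffNr H)
  (cm_sqr H) V1 scaleN1r opprK.
Qed.

(* On an oriented frame e_1, ..., e_6 the volume element e_1 ... e_6 of the
   hypersurface is V, because e_1 ... e_6 V = -1. *)
Lemma volume_normal (eps : 'M[R]_6) :
  (forall z, row_product c (col_mx (eps *m d) V) z = - z) ->
  forall z, frame_product (fun x z => c V (c (x *m d) z)) eps z = c V z.
Proof.
move=> vol z.
(* The six factors V e_i lose their V in pairs, since V X V Y = X Y for tangent X and Y. *)
have -> : frame_product (fun x z => c V (c (x *m d) z)) eps z =
    row_product c (eps *m d) z.
  rewrite /frame_product /row_product !enum_ordSl enum_ord0 /= !normal_tangent_pair.
  by rewrite !row_mul.
have pN u : row_product c (eps *m d) (- u) = - row_product c (eps *m d) u.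
  by rewrite /row_product; elim: (enum _) => //= i s ->; rewrite (cliffNr H).
have := vol (c V z); rewrite row_product_col.
have -> : row_product c V (c V z) = - z.
  by rewrite /row_product enum_ordSl enum_ord0 /= row_id (cm_sqr H) V1 scaleN1r.
by rewrite pN => /oppr_inj.
Qed.

Section Commuting.
Variables (l : F -> F) (eps : 'M[R]_6).
Hypothesis l_lin : forall a u w, l (a *: u + w) = a *: l u + l w.
Hypothesis l_pair : forall x z, l (c V (c (x *m d) z)) = c V (c (x *m d) (l z)).
Hypothesis eps_vol : forall z,
  frame_product (fun x z => c V (c (x *m d) z)) eps z = c V z.

(** The products V X with X tangent generate all Clifford multiplications: V is the product of the
    six V e_i, and X = - V (V X). *)
Lemma commuting_cliff X z : l (c X z) = c X (l z).
Proof.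
have l0 : l 0 = 0 by have := l_lin (-1) 0 0; rewrite scaler0 add0r scaleN1r addNr.
have lD u w : l (u + w) = l u + l w by have := l_lin 1 u w; rewrite !scale1r.
have lZ a u : l (a *: u) = a *: l u by have := l_lin a u 0; rewrite l0 !addr0.
have lV u : l (c V u) = c V (l u).
  rewrite -!eps_vol /frame_product.
  by elim: (enum _) => //= i s IH; rewrite l_pair IH.
have lt x u : l (c (x *m d) u) = c (x *m d) (l u).
  have E w : c (x *m d) w = (-1) *: c V (c V (c (x *m d) w)).
    by rewrite (cm_sqr H) V1 scalerA mulN1r opprK scale1r.
  by rewrite E lZ lV l_pair -E.
have [x [a ->]] := adapted_decomp X.
by rewrite !cE lD lZ lt lV.
Qed.

End Commuting.

Lemma scalar_col (w : {scalar 'rV[R]_6}) x :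
  (x *m (\col_i w (delta_mx 0 i))) 0 0 = w x.
Proof.
rewrite mxE {2}(row_sum_delta x) linear_sum.
by apply: eq_bigr => i _; rewrite linearZ mxE.
Qed.

Variable e : 'M[R]_7.
Hypothesis e_on : forall i j, g (row i e) (row j e) = (i == j)%:R.

(* su(3) is contained in g_2: if the bivector of B maps phi to Y phi, then Y is
   tangent because tr (B J) = 0, and for X orthogonal to Y and J Y, applying the
   bivector to (J X) phi = V X phi gives V X Y phi = 0. *)
Lemma su3_g2 B : skew_form g6 B -> J *m B = B *m J -> \tr (B *m J) = 0 ->
  g2_module g b c phi 2 (extend B 0).
Proof.
move=> sB JB tB; have sA := extend_skew sB.
set A := extend B 0 in sA *.
apply: (bivector0_g2 H e_on) => //.
have ap : b (bivector c e A phi) phi = 0.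
  by have := bivector_skew H e phi phi sA; rewrite (bsym phi) => h; lra.
have [Y EY] := spinor_perp H phi1 span ap.
have YV : g Y V = 0.
  rewrite -(cliff_phi H phi1) -EY /bivector !bE (form_suml blin).
  (* Summand by summand, with J extended by 0 on V: (e_i (A e_i) phi, V phi) = ((A e_i) phi, (J e_i)
     phi) = - g(J A e_i, e_i). *)
  suff -> : \sum_i b (c (row i e) (c (row i e *m A) phi)) (c V phi) =
      - \tr (A *m extend J 0).
    by rewrite extendM extend_trace tB oppr0 mulr0.
  rewrite (trace_frame H e_on) -sumrN; apply: eq_bigr => i _.
  set X := row i e.
  have AV : g (X *m A) V = 0.
    have [x [s ->]] := adapted_decomp X.
    by rewrite mulmxDl -scalemxAl extend_normal scaler0 addr0 extend_tangent0 dV.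
  have EX : c (X *m extend J 0) phi = c V (c X phi) + g X V *: phi.
    have [x [s ->]] := adapted_decomp X.
    rewrite !mulmxDl -!scalemxAl extend_normal scaler0 addr0 extend_tangent0 HJ.
    by rewrite !cE !gE dV V1 (cm_sqr H) V1; apply: bext => z; rewrite !bE; ring.
  rewrite mulmxA (extend_skew complex_skew) opprK -(cliff_phi H phi1) EX.
  by rewrite (cm_skew H) (cliff_anti H X V) !bE (cliff_orth H); ring.
have [y [t EYd]] := adapted_decomp Y.
have t0 : t = 0 by move: YV; rewrite EYd !gE dV V1 add0r mulr1.
have {}EYd : Y = y *m d by rewrite EYd t0 scale0r addr0.
have [x x0 xy] := orthogonal_vector induced_lin
  (fun i : 'I_2 => nth 0 [:: y; y *m J] i) (isT : (2 < 6)%N).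
have gxy : g6 x y = 0 := xy ord0.
have gxJy : g6 x (y *m J) = 0 := xy ord_max.
pose X := x *m d.
have XY : g X Y = 0 by rewrite EYd.
have JXY : g (x *m J *m d) Y = 0.
  by have := complex_skew x y; rewrite gxJy oppr0 EYd.
have anti0 U U' z : g U U' = 0 -> c U (c U' z) = - c U' (c U z).
  by move=> h; rewrite (cliff_anti H) h mulr0 scale0r subr0.
have h1 : bivector c e A (c (x *m J *m d) phi) =
    c (x *m B *m J *m d) phi - c V (c X (c Y phi)).
  rewrite (bivector_comm H e_on) // EY extend_tangent0 -(mulmxA x) JB mulmxA.
  congr (_ + _); rewrite (anti0 _ Y) // HJ -/X (anti0 Y V) // opprK.
  by rewrite (anti0 Y) ?(cliffNr H) // gsym.
have h2 : bivector c e A (c (x *m J *m d) phi) =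
    c (x *m B *m J *m d) phi + c V (c X (c Y phi)).
  rewrite HJ (bivector_comm H e_on) // extend_normal (cliff0l H) add0r.
  by rewrite (bivector_comm H e_on) // EY extend_tangent0 (cliffDr H) -HJ.
have h3 : c V (c X (c Y phi)) = 0.
  apply: bext => z; have := congr1 (b^~ z) (etrans (esym h1) h2).
  by rewrite /= !bE (form0l blin) => h; lra.
have : b (c V (c X (c Y phi))) (c V (c X (c Y phi))) = g X X * g Y Y.
  by rewrite !(cliff_isom H) phi1 V1; ring.
rewrite h3 (form0l blin) => /eqP; rewrite eq_sym mulf_eq0.
rewrite (gt_eqF (induced_pos x0)) /= => /eqP/(form_eq0 (cm_gpos H)) Y0.
by rewrite EY Y0 (cliff0l H).
Qed.

End Hypersurface.

(** * The table *)

Section Table.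
Variables (R : realType) (F : lmodType R).
Variables (g : 'rV[R]_7 -> 'rV[R]_7 -> R) (b : F -> F -> R) (c : 'rV[R]_7 -> F -> F).
Hypothesis H : clifford_module g b c.
Variable phi : F.
Hypothesis phi1 : b phi phi = 1.
Hypothesis span : forall x, exists a X, x = a *: phi + c X phi.
Variables (d : 'M[R]_(6, 7)) (V : 'rV[R]_7).
Hypothesis V1 : g V V = 1.
Hypothesis dV : forall x : 'rV[R]_6, g (x *m d) V = 0.
Hypothesis d_inj : forall x : 'rV[R]_6, x *m d = 0 -> x = 0.
Variable J : 'M[R]_6.
Hypothesis HJ : forall x : 'rV[R]_6, c (x *m J *m d) phi = c V (c (x *m d) phi).
Local Notation g6 := (induced_form g d).

Definition weingarten_at (t : weingarten_type) (W : 'M[R]_6) : Prop :=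
  match t with
  | type_zero => W = 0
  | type_one => exists m : R, W = m%:M
  | type_two => [/\ sym_form g6 W, \tr W = 0 & J *m W = W *m J]
  | type_three => [/\ sym_form g6 W, \tr W = 0 & J *m W = - (W *m J)]
  end.

Definition SU3_at (s : SU3_type) (S : 'M[R]_6) (w : 'cV[R]_6) : Prop :=
  match s with
  | chi1 => (exists l : R, S = l *: J) /\ w = 0
  | chi1bar => (exists m : R, S = m%:M) /\ w = 0
  | chi2 => [/\ skew_form g6 S, J *m S = S *m J & \tr (S *m J) = 0] /\ w = 0
  | chi2bar => [/\ sym_form g6 S, \tr S = 0 & J *m S = S *m J] /\ w = 0
  | chi3 => [/\ sym_form g6 S, \tr S = 0 & J *m S = - (S *m J)] /\ w = 0
  | chi4 => [/\ skew_form g6 S & J *m S = - (S *m J)] /\ w = 0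
  | chi5 => S = 0
  end.

Let e := projT1 (cid (orthonormal_frame_exists (cm_glin H) (cm_gsym H) (cm_gpos H))).
Let e_on i j : g (row i e) (row j e) = (i == j)%:R.
Proof. by rewrite /e; case: cid. Qed.

Let ilin := induced_lin H d.
Let isym := induced_sym H d.
Let ipos := induced_pos H d_inj.
Let J2 := complex_sqr H phi1 V1 d_inj HJ.

Lemma sym_mul_complex_tr0 S : sym_form g6 S -> \tr (S *m J) = 0.
Proof.
by move=> sS; apply: (sym_skew_tr0 ilin isym ipos sS (complex_skew H phi1 HJ)).
Qed.

Lemma scalar_module m : g2_module g b c phi 4 (extend d V (m%:M *m J) 0).
Proof.
rewrite mul_scalar_mx -[0](scaler0 _ m) (extendZ H) //; apply: (g2_moduleZ H).
exact: (extend_complex_module H).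
Qed.

Lemma commuting_module S : sym_form g6 S -> \tr S = 0 -> J *m S = S *m J ->
  g2_module g b c phi 2 (extend d V (S *m J) 0).
Proof.
move=> sS tS JS.
apply: (su3_g2 H phi1 span V1 dV d_inj HJ e_on).
- exact: (sym_commuting_skew H phi1 HJ).
- by rewrite mulmxA JS.
- by rewrite -mulmxA J2 mulmxN mulmx1 raddfN /= tS oppr0.
Qed.

Lemma anticommuting_module S : sym_form g6 S -> J *m S = - (S *m J) ->
  g2_module g b c phi 3 (extend d V (S *m J) 0).
Proof.
move=> sS JS.
apply: (extend_sym_module H) => //.
  exact: (sym_anticommuting_sym H phi1 HJ).
exact: sym_mul_complex_tr0.
Qed.

Definition weingarten_list (t : weingarten_type) : seq nat :=
  match t with
  | type_zero => [::]
  | type_one => [:: 4]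
  | type_two => [:: 2]
  | type_three => [:: 3]
  end%N.

(** What S alone contributes to a cell, [weingarten_list] giving the part of W. The entry of [chi5]
    is a default value: [table_class] treats that column separately. *)
Definition SU3_list (s : SU3_type) : seq nat :=
  match s with
  | chi1 => [:: 1; 3]
  | chi1bar => [:: 4]
  | chi2 => [:: 3]
  | chi2bar => [:: 2]
  | chi3 => [:: 3]
  | chi4 => [:: 2; 4]
  | chi5 => [::]
  end%N.

Lemma extend0 : extend d V 0 0 = 0.
Proof. by have := extendZ H V1 dV d_inj 0 0 0; rewrite !scale0r. Qed.

Lemma weingarten_contribution t W : weingarten_at t W ->
  g2_class g b c phi (weingarten_list t) (extend d V (W *m J) 0).
Proof.
case: t => /= [->|[m ->]|[sW tW JW]|[sW tW JW]].
- by exists (fun=> 0) => //; rewrite mul0mx extend0 big_nil.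
- by apply: (@g2_module_class _ _ _ _ _ H _ _ 4%N) => //; apply: scalar_module.
- by apply: (@g2_module_class _ _ _ _ _ H _ _ 2%N) => //; apply: commuting_module.
- by apply: (@g2_module_class _ _ _ _ _ H _ _ 3%N) => //; apply: anticommuting_module.
Qed.

(** Composition with J permutes the types: it exchanges symmetric and skew for S commuting with J,
    keeps them for S anticommuting with J, and sends J to - Id and Id to J. *)
Lemma SU3_contribution s S w : s <> chi5 -> SU3_at s S w ->
  w = 0 /\ g2_class g b c phi (SU3_list s) (extend d V (S *m J) 0).
Proof.
case: s => // _ /= [hS ->]; split=> //.
- case: hS => l ->; rewrite -scalemxAl J2 scalerN -scaleNr.
  rewrite -[0](scaler0 _ (- l)) (extendZ H) //; apply: (g2_classZ H).
  exact: (extend_id_class H).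
- case: hS => m ->.
  by apply: (@g2_module_class _ _ _ _ _ H _ _ 4%N) => //; apply: scalar_module.
- case: hS => sS JS tS.
  apply: (@g2_module_class _ _ _ _ _ H _ _ 3%N) => //.
  apply: (extend_sym_module H) => //.
  exact: (skew_commuting_sym H phi1 HJ).
- case: hS => sS tS JS.
  by apply: (@g2_module_class _ _ _ _ _ H _ _ 2%N) => //; apply: commuting_module.
- case: hS => sS tS JS.
  by apply: (@g2_module_class _ _ _ _ _ H _ _ 3%N) => //; apply: anticommuting_module.
- case: hS => sS JS.
  apply: (skew_class H phi1 span e_on) => //.
  apply: (extend_skew H) => //.
  exact: (skew_anticommuting_skew H phi1 HJ).
Qed.

Lemma weingarten_sym t W : weingarten_at t W -> sym_form g6 W.
Proof.
case: t => /= [->|[m ->]|[]|[]] // x y.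
  by rewrite !mulmx0 (form0l ilin) (form0r ilin isym).
by rewrite !mul_mx_scalar (formZl ilin) (formZr ilin isym).
Qed.

Lemma table_class t s S W w : weingarten_at t W -> SU3_at s S w ->
  g2_class g b c phi (G2_table t s) (extend d V (S *m J - 2^-1 *: (W *m J)) w).
Proof.
move=> hW hS.
(* For [chi5] the endomorphism is x |-> w(x) V - (1/2) J W x, with V sent to 0. Its trace vanishes:
   the first term maps TM to the span of V, and in the second W is symmetric and J skew. *)
have [s5|s5] := pselect (s = chi5).
  have -> : G2_table t s = [:: 2; 3; 4]%N by rewrite s5; case: (t).
  move: hS; rewrite s5 /= => ->; rewrite mul0mx sub0r.
  apply: (traceless_class H phi1 span e_on).
  rewrite (extend_trace H) // raddfN /= linearZ /=.
  by rewrite (sym_mul_complex_tr0 (weingarten_sym hW)) mulr0 oppr0.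
have [-> cS] := SU3_contribution s5 hS.
have cW := g2_classZ H (- 2^-1) (weingarten_contribution hW).
have -> : extend d V (S *m J - 2^-1 *: (W *m J)) 0 =
    extend d V (S *m J) 0 + (- 2^-1) *: extend d V (W *m J) 0.
  by rewrite -(extendZ H) // -(extendD H) // scaler0 addr0 scaleNr.
apply: (g2_classD H).
  by apply: (g2_class_sub H) cS; case: (t) (s) s5 {hW cW hS} => -[] // _; apply/allP.
by apply: (g2_class_sub H) cW; case: (t) (s) s5 {hW cS hS} => -[] // _; apply/allP.
Qed.

End Table.

(** * The spinorial Gauss formula *)

Section SpinorialGauss.
Variables (R : realType) (N : manifold R 7) (gN : bmetric (tangent N)).
Variables (o : orientation N) (Sg : spinor_bundle gN o).
Variables (DN : connection (tangent N)) (DNS : connection Sg).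
Hypothesis hDNS : spin_lift (sprod Sg) (@cliff R N gN o Sg) DN DNS.
Variables (phi : forall q : N, Sg q) (hphi : unit_spinor_field phi).
Variables (M : manifold R 6) (g : bmetric (tangent M)) (f : M -> N).
Hypothesis hf : embedding f.
Hypothesis hg : forall (p : M) (X Y : 'rV[R]_6),
  g p X Y = gN (f p) (X *m dmap f p) (Y *m dmap f p).
Variables (V : forall p : M, pullback f (tangent N) p) (hV : unit_normal gN V).
Variables (D : connection (tangent M)) (DS : connection (pullback f Sg)).
Hypothesis hDS : @spin_lift R 6 M (pullback f Sg) (fun p => sprod Sg (f p))
  (@hyper_cliff R N gN o Sg M f V) D DS.
Variables (DNf : connection (pullback f (tangent N))).
Hypothesis hDNf : pullback_connection DN DNf.
Variables (W : M -> 'M[R]_6) (hW : weingarten_map g V DNf D W).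
Variables (j : forall p : M, pullback f Sg p -> pullback f Sg p).
Hypothesis hj : volume_element g V j.
Variable J : M -> 'M[R]_6.
Hypothesis hJ : almost_complex_structure V phi j J.
Variable p : M.

Local Notation y := (f p).
Local Notation gy := (gN y : 'rV[R]_7 -> 'rV[R]_7 -> R).
Local Notation by' := (sprod Sg y : Sg y -> Sg y -> R).
Local Notation cy := (@cliff R N gN o Sg y).
Local Notation d := (dmap f p : 'M[R]_(6, 7)).
Local Notation Vp := (V p : 'rV[R]_7).

Lemma cliff_module q : clifford_module (gN q : 'rV[R]_7 -> 'rV[R]_7 -> R)
  (sprod Sg q : Sg q -> Sg q -> R) (@cliff R N gN o Sg q).
Proof.
split.
- exact: (bform_lin gN).
- exact: (bform_sym gN).
- exact: (@bform_pos _ _ _ _ gN q).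
- exact: (bform_lin (sprod Sg)).
- exact: (bform_sym (sprod Sg)).
- exact: (@bform_pos _ _ _ _ (sprod Sg) q).
- exact: cliff_linl.
- exact: cliff_linr.
- exact: cliff_sqr.
- exact: cliff_skew.
Qed.

Let H := cliff_module y.
Let phi1 : by' (phi y) (phi y) = 1 := (hphi y).2.

Let fs : smooth_map f. Proof. by case: hf. Qed.

Let Sv := spinors_bundle Sg.

Let span (x : Sg y) : exists a X, x = a *: phi y + cy X (phi y).
Proof. exact: (spinor_span H phi1 (vb_basis Sv y)). Qed.

Let V1 : gy Vp Vp = 1. Proof. by have [] := hV p. Qed.
Let dV (x : 'rV[R]_6) : gy (x *m d) Vp = 0. Proof. by have [] := hV p. Qed.
Let d_inj (x : 'rV[R]_6) : x *m d = 0 -> x = 0.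
Proof. by have [_ + _ _] := hf; apply. Qed.

Lemma adapted_orthonormal (a : 'M[R]_6) : orthonormal_frame g p a ->
  @orthonormal_frame R 7 N gN y (col_mx (a *m d) Vp : 'M[R]_(6 + 1)).
Proof.
move=> on.
suff E (i k : 'I_(6 + 1)) : gy (row i (col_mx (a *m d) Vp)) (row k (col_mx (a *m d) Vp)) =
    (i == k)%:R by exact: E.
rewrite -(fintype.splitK i) -(fintype.splitK k).
case: (fintype.split i) (fintype.split k) => [i'|i'] [k'|k'] /=;
  rewrite !(rowKu, rowKd) ?row_mul.
- by rewrite -hg on (inj_eq (@lshift_inj 6 1)).
- by rewrite !ord1 row_id dV -val_eqE /= ltn_eqF.
- by rewrite !ord1 row_id (cm_gsym H) dV -val_eqE /= gtn_eqF.
- by rewrite !ord1 row_id V1 eqxx.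
Qed.

Lemma oriented_frame : exists eps : 'M[R]_6,
  orthonormal_frame g p eps /\ hyper_pos_frame o V p eps.
Proof.
have [eps Heps] := orthonormal_frame_exists (@bform_lin _ _ _ _ g p)
  (@bform_sym _ _ _ _ g p) (@bform_pos _ _ _ _ g p).
pose E (a : 'M[R]_6) : 'M[R]_(6 + 1) := col_mx (a *m d) Vp.
have nz : o y * \det (E eps) != 0.
  rewrite mulf_neq0 //; first by have [->|->] := osign_unit o y; rewrite ?oppr_eq0 oner_eq0.
  have := frame_unit (cm_glin H) (adapted_orthonormal Heps).
  by rewrite unitmxE unitfE.
have [pos|neg] := ltP 0 (o y * \det (E eps)); first by exists eps.
(* A frame of the wrong sign is corrected by exchanging its first and last vectors. *)
pose s := tperm_mx (ord0 : 'I_6) ord_max : 'M[R]_6.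
exists (s *m eps); split.
  move=> i k; rewrite !row_mul.
  have rs l : row l s *m eps = row (tperm ord0 ord_max l) eps.
    by rewrite -row_mul /s /tperm_mx -row_permE; apply/rowP => m; rewrite !mxE.
  by rewrite !rs Heps (inj_eq perm_inj).
have detE : \det (E (s *m eps)) = - \det (E eps).
  have -> : E (s *m eps) = block_mx s 0 0 1%:M *m E eps.
    by rewrite mul_block_col !mul0mx mul1mx addr0 add0r /E mulmxA.
  rewrite det_mulmx det_ublock det1 mulr1 /s /tperm_mx det_perm odd_tperm /=.
  by rewrite expr1 mulN1r.
suff : 0 < o y * \det (E (s *m eps)) by [].
by rewrite detE mulrN oppr_gt0 lt_neqAle nz.
Qed.

Let vol : exists eps : 'M[R]_6,
  (forall z, frame_product (fun x z => cy Vp (cy (x *m d) z)) eps z = cy Vp z) /\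
  (forall z, @j p z = frame_product (fun x z => cy Vp (cy (x *m d) z)) eps z).
Proof.
have [eps [on pos]] := oriented_frame; exists eps; split.
  apply: (volume_normal H V1 dV) => z.
  exact: (cliff_vol z (adapted_orthonormal on) pos).
by move=> z; exact: (hj z on pos).
Qed.

Lemma volume_elementE z : @j p z = cy Vp z.
Proof. by have [eps [e1 e2]] := vol; rewrite e2 e1. Qed.

Lemma complexE (x : 'rV[R]_6) :
  cy (x *m J p *m d) (phi y) = cy Vp (cy (x *m d) (phi y)).
Proof.
have := congr1 (cy Vp) (hJ p x); rewrite volume_elementE /hyper_cliff.
by rewrite !(cm_sqr H) V1 !scaleN1r => /oppr_inj.
Qed.

Section Direction.
Variable v : 'rV[R]_6.
Variable L : Sg y -> Sg y.
Hypothesis L_lin : forall a x z, L (a *: x + z) = a *: L x + L z.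
Hypothesis LE : forall s : forall q, Sg q, smooth_sec s y ->
  DS p v (fun q => s (f q)) = DNS y (v *m d) s + L (s y).

Let K : (forall q, pullback f Sg q) -> Sg y := @pb_nabla R 6 7 M N f Sg DS p v L.

Let Kcliff (Y : forall q, pullback f (tangent N) q) (s : forall q, pullback f Sg q) :
  smooth_sec Y p -> smooth_sec s p ->
  smooth_sec (fun q => cliff (Y q) (s q) : pullback f Sg q) p /\
  K (fun q => cliff (Y q) (s q)) = cy (DNf p v Y) (s p) + cy (Y p) (K s).
Proof.
apply: (@pb_nabla_cliff R 6 7 M N f Sg DNS DS p v (@cliff R N gN o Sg) _ _ _
  DN DNf hDNf _ L L_lin LE).
- exact: (@cliff_linl _ _ _ _ Sg).
- exact: (@cliff_linr _ _ _ _ Sg).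
- exact: (@cliff_smooth _ _ _ _ Sg).
- by case: hDNS.
Qed.

(** Metric compatibility along [f], read off from the spinors: differentiating (Y Y' + Y' Y) phi = -
    2 k phi with [Kcliff], the terms in K phi cancel, and pairing the rest with phi gives - 2 times
    the asserted sum. *)
Lemma pullback_metric_cst (k : R) (Y Y' : forall q, pullback f (tangent N) q) :
  smooth_sec Y p -> smooth_sec Y' p -> (forall q, gN (f q) (Y q) (Y' q) = k) ->
  gy (DNf p v Y) (Y' p) + gy (Y p) (DNf p v Y') = 0.
Proof.
move=> sY sY' Hk.
have ss : @smooth_sec _ _ _ (pullback f Sg) (fun q => phi (f q)) p.
  exact: (pb_comp (hphi y).1).
have [s1 E1] := Kcliff sY' ss; have [s2 E2] := Kcliff sY s1.
have [s1' E1'] := Kcliff sY ss; have [s2' E2'] := Kcliff sY' s1'.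
have := pb_nabla_add DS v L_lin s2 s2'.
rewrite -/K E2 E1 E2' E1'.
have -> : (fun q => cliff (Y q) (cliff (Y' q) (phi (f q))) +
    cliff (Y' q) (cliff (Y q) (phi (f q)))) = (fun q => (- (2 * k)) *: phi (f q)).
  apply: functional_extensionality_dep => q.
  by rewrite (cliff_anti (cliff_module _) (Y q)) Hk addrAC addNr add0r scaleNr.
have := pb_nabla_scale DS v L_lin (smooth_fun_cst (- (2 * k)) p) ss.
rewrite -/K dirder_cst scale0r add0r => -> e.
have := congr1 (fun z => by' z (phi y)) e; move: (K _) => k0.
rewrite (cliff_anti H (DNf p v Y) (Y' p)) (cliff_anti H (DNf p v Y') (Y p)).
rewrite !(cliffDr H) (cliff_anti H (Y p) (Y' p) k0) Hk.
rewrite !(formDl (cm_blin H), formNl (cm_blin H), formZl (cm_blin H)) phi1.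
rewrite (cm_gsym H _ (Y p)) => h; lra.
Qed.

Let field_smooth (x : 'rV[R]_6) := mul_dmap_smooth fs (@coord_field_smooth R 6 M p x).

Let field_derivative (x : 'rV[R]_6) :
  DNf p v (fun q => coord_field p x q *m dmap f q : tangent N (f q)) =
    D p v (coord_field p x) *m d + gy (v *m W p *m d) (x *m d) *: Vp :> 'rV[R]_7.
Proof.
have := hW v (@coord_field_smooth R 6 M p x).
by rewrite (coord_field_center p x) hg.
Qed.

(** The Weingarten equation. Its normal and tangent components come from differentiating the
    constants g(V, V) = 1 and g(V, X) = 0, where X is the push-forward of a coordinate field of
    M. *)
Lemma normal_derivative : DNf p v V = - (v *m W p *m d) :> 'rV[R]_7.
Proof.
have VV : gy (DNf p v V) Vp = 0.
  have sV : smooth_sec V p by have [] := hV p.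
  have V2 q : gN (f q) (V q) (V q) = 1 by have [] := hV q.
  have := pullback_metric_cst sV sV V2.
  by rewrite (cm_gsym H Vp) => h; lra.
have VX x : gy (DNf p v V) (x *m d) = - gy (v *m W p *m d) (x *m d).
  have sV : smooth_sec V p by have [] := hV p.
  have VX q : gN (f q) (V q) (coord_field p x q *m dmap f q) = 0.
    by rewrite (cm_gsym (cliff_module _)); have [_ _] := hV q; apply.
  have := pullback_metric_cst sV (field_smooth x) VX.
  rewrite field_derivative (coord_field_center p x).
  rewrite (formDr (cm_glin H) (cm_gsym H)) (formZr (cm_glin H) (cm_gsym H)).
  rewrite V1 mulr1 (cm_gsym H Vp) dV add0r => h; lra.
apply: (form_ext (cm_glin H) (cm_gpos H)) => Z.
have [x [a ->]] := adapted_decomp H V1 dV d_inj Z.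
rewrite !(formDr (cm_glin H) (cm_gsym H)) !(formZr (cm_glin H) (cm_gsym H)).
by rewrite !(formNl (cm_glin H)) VV VX dV oppr0.
Qed.

(** The product V X is differentiated by the intrinsic rule of [DS] and by the ambient rule of K.
    The two differ by the derivative - W(v) of V and by the normal part g(W(v), X) V of the
    derivative of X, which multiplication by V turns into - g(W(v), X). *)
Lemma difference_pair x z : L (cy Vp (cy (x *m d) z)) =
  cy Vp (cy (x *m d) (L z)) +
  (cy (v *m W p *m d) (cy (x *m d) z) + gy (v *m W p *m d) (x *m d) *: z).
Proof.
have [s ss sz] := vb_extend Sv z.
have sV : smooth_sec V p by have [] := hV p.
have ss' := pb_comp ss.
have [s1 E1] := Kcliff (field_smooth x) ss'.
have [s2 E2] := Kcliff sV s1.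
have [_ /(_ p v _ _ (@coord_field_smooth R 6 M p x) ss') E3] := hDS.
have := E2; rewrite E1 normal_derivative field_derivative.
rewrite {1}/K /pb_nabla.
have -> : DS p v (fun q => cliff (V q) (cliff (coord_field p x q *m dmap f q) (s (f q)))) =
  cy Vp (cy (D p v (coord_field p x) *m d) z) + cy Vp (cy (x *m d) (K (fun q => s (f q)) + L z)).
  rewrite [LHS]E3 /hyper_cliff (coord_field_center p x) sz.
  by rewrite /K /pb_nabla sz subrK.
rewrite (coord_field_center p x) sz; move: (K _) => k0 e.
apply: (form_ext (cm_blin H) (cm_bpos H)) => w.
have := congr1 (fun z => by' z w) e.
rewrite !(cliffDl H) !(cliffDr H) !(cliffNl H) !(cliffZl H) !(cliffZr H) (cm_sqr H) V1.
rewrite !(formDl (cm_blin H), formNl (cm_blin H), formZl (cm_blin H)) => h; lra.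
Qed.

Lemma difference_skew z w : by' (L z) w = - by' z (L w).
Proof.
have [s ss sz] := vb_extend Sv z; have [t st tw] := vb_extend Sv w.
have [m1 _] := hDS; have [m2 _] := hDNS.
have := m1 p v _ _ (pb_comp ss) (pb_comp st).
have := m2 y (v *m d) _ _ ss st.
rewrite -(dirder_comp_map fs _ (bform_smooth (sprod Sg) ss st)) => ->.
rewrite !LE // sz tw.
rewrite (formDl (cm_blin H)) (formDr (cm_blin H) (cm_bsym H)) => h; lra.
Qed.

Lemma difference_parallel : L (phi y) = 2^-1 *: cy Vp (cy (v *m W p *m d) (phi y)).
Proof.
(* The correction is dictated by [difference_pair]: the commutator of (1/2) V W(v) with V X is (1/2)
   (W(v) X - X W(v)) = W(v) X + g(W(v), X). *)
pose l z := L z - 2^-1 *: cy Vp (cy (v *m W p *m d) z).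
have l_lin a u w : l (a *: u + w) = a *: l u + l w.
  apply: (form_ext (cm_blin H) (cm_bpos H)) => t.
  rewrite /l L_lin !(cliffDr H) !(cliffZr H).
  by rewrite !(formDl (cm_blin H), formNl (cm_blin H), formZl (cm_blin H)); ring.
have l_pair x z : l (cy Vp (cy (x *m d) z)) = cy Vp (cy (x *m d) (l z)).
  apply: (form_ext (cm_blin H) (cm_bpos H)) => t.
  rewrite /l difference_pair !(cliffDr H) !(cliffNr H) !(cliffZr H).
  rewrite !(normal_tangent_pair H V1 dV) (cliff_anti H (x *m d) (v *m W p *m d)).
  rewrite !(formDl (cm_blin H), formNl (cm_blin H), formZl (cm_blin H)).
  rewrite (cm_gsym H (x *m d)); lra.
have [eps [eps_vol _]] := vol.
have lc := commuting_cliff H V1 dV d_inj l_lin l_pair eps_vol.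
have ls z w : by' (l z) w = - by' z (l w).
  rewrite /l !(formDl (cm_blin H), formNl (cm_blin H), formZl (cm_blin H)).
  rewrite !(formDr (cm_blin H) (cm_bsym H), formNr (cm_blin H) (cm_bsym H),
    formZr (cm_blin H) (cm_bsym H)).
  rewrite difference_skew (cm_skew H) (cm_skew H) (cliff_anti H _ Vp) dV.
  rewrite mulr0 scale0r subr0 (formNr (cm_blin H) (cm_bsym H)); ring.
by apply/eqP; rewrite -subr_eq0; apply/eqP/(commuting_skew_spinor0 H phi1 span _ lc ls).
Qed.

End Direction.

Lemma spinorial_gauss v : DS p v (fun q => phi (f q)) =
  DNS y (v *m d) phi + 2^-1 *: cy Vp (cy (v *m W p *m d) (phi y)).
Proof.
have [L [L_lin LE]] := connection_difference fs Sv DNS DS p v.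
by rewrite LE ?(difference_parallel L_lin LE) //; case: (hphi y).
Qed.

End SpinorialGauss.

Theorem theorem5p4 (R : realType)
  (* the G_2-manifold (N, gN, phi), of intrinsic endomorphism SN *)
  (N : manifold R 7) (gN : bmetric (tangent N)) (o : orientation N)
  (Sg : spinor_bundle gN o)
  (DN : connection (tangent N)) (DNS : connection Sg)
  (hDN : levi_civita gN DN)
  (hDNS : spin_lift (sprod Sg) (@cliff R N gN o Sg) DN DNS)
  (phi : forall q : N, Sg q) (hphi : unit_spinor_field phi)
  (SN : N -> 'M[R]_7) (hSN : intrinsic_endomorphism phi DNS SN)
  (* the hypersurface f : (M, g) -> N of unit normal V *)
  (M : manifold R 6) (g : bmetric (tangent M)) (f : M -> N)
  (hf : embedding f)
  (hg : forall (p : M) (X Y : 'rV[R]_6),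
      g p X Y = gN (f p) (X *m dmap f p) (Y *m dmap f p))
  (V : forall p : M, pullback f (tangent N) p) (hV : unit_normal gN V)
  (* its Levi-Civita connection, with its spinor lift, and Weingarten map *)
  (D : connection (tangent M)) (DS : connection (pullback f Sg))
  (hD : levi_civita g D)
  (hDS : @spin_lift R 6 M (pullback f Sg) (fun p => sprod Sg (f p))
           (@hyper_cliff R N gN o Sg M f V) D DS)
  (DNf : connection (pullback f (tangent N)))
  (hDNf : pullback_connection DN DNf)
  (W : M -> 'M[R]_6) (hW : weingarten_map g V DNf D W)
  (* the SU(3)-structure defined by the restriction of phi *)
  (j : forall p : M, pullback f Sg p -> pullback f Sg p)
  (hj : volume_element g V j)
  (J : M -> 'M[R]_6) (hJ : almost_complex_structure V phi j J)
  (S : M -> 'M[R]_6) (eta : M -> {scalar 'rV[R]_6})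
  (hS : intrinsic_tensors V phi j DS S eta)
  (* phi is parallel in the normal direction *)
  (hpar : forall p : M, DNS (f p) (V p) phi = 0)
  (t : weingarten_type) (ht : weingarten_class g J W t)
  (c : SU3_type) (hc : SU3_class g J S eta c) :
  forall p : M, G2_class phi (f p) (G2_table t c) (SN (f p)).
Proof.
move=> p.
have H := cliff_module Sg (f p).
have phi1 : sprod Sg (f p) (phi (f p)) (phi (f p)) = 1 := (hphi (f p)).2.
have span := spinor_span H phi1 (vb_basis (spinors_bundle Sg) (f p)).
have [_ V1 dV] := hV p.
have d_inj (x : 'rV[R]_6) : x *m dmap f p = 0 -> x = 0.
  by have [_ + _ _] := hf; apply.
have jE z : j p z = cliff (V p : 'rV[R]_7) z := volume_elementE hg hV hj z.
have HJ x := complexE hg hV hj hJ p x.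
have gE (x y : 'rV[R]_6) : g p x y = induced_form (gN (f p)) (dmap f p) x y := hg p x y.
pose w : 'cV[R]_6 := \col_i eta p (delta_mx 0 i).
have cinj := cliff_inj H phi1.
have SNE : SN (f p) = extend (dmap f p) (V p) (S p *m J p - 2^-1 *: (W p *m J p)) w.
  apply: (extend_unique H V1 dV d_inj).
    by apply: cinj; rewrite (cliff0l H) -hSN hpar.
  move=> x; apply: cinj; rewrite -hSN.
  have := spinorial_gauss hDNS hphi hf hg hV hDS hDNf hW hj p x.
  rewrite hS jE /hyper_cliff -!HJ => e.
  rewrite (scalar_col (eta p)) mulmxBr mulmxBl -scalemxAr -scalemxAl !mulmxA.
  rewrite (cliffDl H) (cliffDl H) (cliffNl H) !(cliffZl H).
  apply: (form_ext (cm_blin H) (cm_bpos H)) => z.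
  have := congr1 (fun u => sprod Sg (f p) u z) e.
  rewrite !(formDl (cm_blin H), formNl (cm_blin H), formZl (cm_blin H)) => h; lra.
have tW : weingarten_at (gN (f p)) (dmap f p) (J p) t (W p).
  case: t ht => /= ht; try exact: ht.
  - by have [sW tW cW] := ht p; split=> // x y; rewrite -!gE.
  - by have [sW tW cW] := ht p; split=> // x y; rewrite -!gE.
have w0 : (forall p X, eta p X = 0) -> w = 0.
  by move=> e0; apply/colP => i; rewrite !mxE e0.
have cS : SU3_at (gN (f p)) (dmap f p) (J p) c (S p) w.
  case: c hc => /= -[hc e0]; try (split; last exact: w0).
  - exact: hc.
  - exact: hc.
  - by have [sS JS tS] := hc p; split=> // x y; rewrite -!gE.
  - by have [sS tS JS] := hc p; split=> // x y; rewrite -!gE.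
  - by have [sS tS JS] := hc p; split=> // x y; rewrite -!gE.
  - by have [sS JS] := hc p; split=> // x y; rewrite -!gE.
  - exact: hc.
rewrite SNE.
exact: (table_class H phi1 span V1 dV d_inj HJ tW cS).
Qed.
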